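(* Let $H^2_\beta$ be a weighted Hardy space of polynomial growth. For any $\varphi\in\mathrm{Aut}(\mathbb{D})$, the Hermitian holomorphic vector bundles $E_{S_\beta}$ and $E_{\varphi(S_\beta)}$ (over $\mathbb{D}$) are similar.
   Context: $\mathbb{D}$ is the open unit disk and $\mathrm{Aut}(\mathbb{D})$ is the group of analytic bijections $\mathbb{D}\to\mathbb{D}$ (M\''obius transformations $e^{i\theta}\frac{z_0-z}{1-\overline{z_0}z}$, $\theta\in\mathbb{R}$, $z_0\in\mathbb{D}$). $\beta=\{\beta_k\}_{k\ge0}$ is a sequence of positive numbers with $\beta_0=1$, $w_k=\beta_k/\beta_{k-1}$ ($k\ge1$), with $w_k\to1$. $H^2_\beta=\{f(z)=\sum_{k\ge0}\widehat f(k)z^k:\ \sum_k|\widehat f(k)|^2\beta_k^2<\infty\}$ with $\langle f,g\rangle=\sum_k\beta_k^2\,\widehat f(k)\overline{\widehat g(k)}$. It is of polynomial growth if $\sup_k(k+1)|w_k-1|<\infty$. $S_\beta$ is the bounded operator on $H^2_\beta$ given by $S_\beta f(z)=(f(z)-f(0))/z$; its spectrum is $\overline{\mathbb{D}}$, and $\varphi(S_\beta)$ is defined by the holomorphic functional calculus. $E_{S_\beta}$ and $E_{\varphi(S_\beta)}$ are the Hermitian holomorphic vector bundles over $\mathbb{D}$ in $H^2_\beta$ with fibres $\mathrm{Ker}(S_\beta-\omega\mathbf{I})$ and $\mathrm{Ker}(\varphi(S_\beta)-\omega\mathbf{I})$, $\omega\in\mathbb{D}$. Two such bundles $E,\widetilde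 E$ are similar if there is a bounded invertible linear operator $X$ on $H^2_\beta$ with $XE(\omega)=\widetilde E(\omega)$ for all $\omega\in\mathbb{D}$. *)

(* Defs.v *)
From Stdlib Require Import Reals Lra.
From Coquelicot Require Import Coquelicot.

Open Scope R_scope.

Definition unit_disk (z : C) : Prop := Cmod z < 1.

Definition moebius (theta : R) (z0 z : C) : C :=
  ((cos theta, sin theta) * ((z0 - z) / (1 - Cconj z0 * z)))%C.

(* The maps are taken on all of [C] and not only on the disk, because
   [phi (S_beta)] involves the values of [phi] near the closed unit disk.  If
   [z0 <> 0], the value at the pole [/ Cconj z0], which lies outside the closed
   disk, is a junk value; it is never used, since [is_hol_calculus] only
   integrates over circles bounding a disk on which [phi] is holomorphic. *)
Definition Aut_disk (phi : C -> C) : Prop :=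
  exists (theta : R) (z0 : C),
    unit_disk z0 /\ forall z : C, phi z = moebius theta z0 z.

Definition holomorphic_at (phi : C -> C) (z : C) : Prop :=
  @ex_derive C_AbsRing C_NormedModule phi z.

Definition weight_ratio (beta : nat -> R) (k : nat) : R :=
  beta k / beta (pred k).

Definition admissible_weight (beta : nat -> R) : Prop :=
  (forall k, 0 < beta k) /\ beta 0%nat = 1 /\ is_lim_seq (weight_ratio beta) 1.

Definition polynomial_growth (beta : nat -> R) : Prop :=
  exists M : R, forall k : nat, (1 <= k)%nat ->
    (INR k + 1) * Rabs (weight_ratio beta k - 1) <= M.

(* A function [f] in the weighted Hardy space is represented by the sequence
   of its Taylor coefficients at the origin. *)
Definition H2 (beta : nat -> R) (f : nat -> C) : Prop :=
  ex_series (fun k => Cmod (f k) ^ 2 * beta k ^ 2).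

(* [Series] sums real series, so the real and imaginary parts are separated. *)
Definition inner (beta : nat -> R) (f g : nat -> C) : C :=
  (Series (fun k => beta k ^ 2 * Re (f k * Cconj (g k))%C),
   Series (fun k => beta k ^ 2 * Im (f k * Cconj (g k))%C)).

Definition norm2 (beta : nat -> R) (f : nat -> C) : R :=
  sqrt (Re (inner beta f f)).

(* An operator is a map on all coefficient sequences, of which only the
   restriction to [H2 beta] is relevant. *)
Definition operator : Type := (nat -> C) -> (nat -> C).

Definition bounded_operator (beta : nat -> R) (T : operator) : Prop :=
  (forall f, H2 beta f -> H2 beta (T f)) /\
  (forall (a b : C) f g, H2 beta f -> H2 beta g ->
     T (fun k => a * f k + b * g k)%C = (fun k => a * T f k + b * T g k)%C) /\
  (exists M : R, forall f, H2 beta f -> norm2 beta (T f) <= M * norm2 beta f).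

Definition bounded_invertible (beta : nat -> R) (X : operator) : Prop :=
  bounded_operator beta X /\
  exists Y : operator, bounded_operator beta Y /\
    forall f, H2 beta f -> Y (X f) = f /\ X (Y f) = f.

Definition is_resolvent (beta : nat -> R) (T : operator) (lambda : C)
    (Q : operator) : Prop :=
  bounded_operator beta Q /\
  forall f, H2 beta f ->
    Q (fun k => lambda * f k - T f k)%C = f /\
    (fun k => lambda * Q f k - T (Q f) k)%C = f.

Definition spectrum (beta : nat -> R) (T : operator) (lambda : C) : Prop :=
  ~ exists Q : operator, is_resolvent beta T lambda Q.

(* [v] is the contour integral of [h] over the positively oriented circle
   [t |-> r * exp (i * t)]. *)
Definition is_circle_integral (h : C -> C) (r : R) (v : C) : Prop :=
  @is_RInt C_R_NormedModule
    (fun t => let z := (r * cos t, r * sin t) in (h z * (Ci * z))%C)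
    0 (2 * PI) v.

(* [A = 1/(2 pi i) * \oint phi(lambda) (lambda - T)^(-1) d lambda], as a weak
   operator-valued integral, over a circle around the spectrum of [T] bounding
   a disk in a neighbourhood of whose closure [phi] is holomorphic.  By Cauchy's
   theorem [A] does not depend on the radius [r]. *)
Definition is_hol_calculus (beta : nat -> R) (T : operator) (phi : C -> C)
    (A : operator) : Prop :=
  bounded_operator beta A /\
  exists (r rho : R) (Q : C -> operator),
    0 < r < rho /\
    (forall lambda, spectrum beta T lambda -> Cmod lambda < r) /\
    (forall z, Cmod z < rho -> holomorphic_at phi z) /\
    (forall lambda, Cmod lambda = r -> is_resolvent beta T lambda (Q lambda)) /\
    (forall f g, H2 beta f -> H2 beta g ->
       is_circle_integral
         (fun lambda => phi lambda * inner beta (Q lambda f) g)%C r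
         (2 * PI * Ci * inner beta (A f) g)%C).

(* On Taylor coefficients, [f |-> (f - f(0)) / z] is the shift
   [PS_decr_1 f = fun k => f (S k)]; see [S_beta_eval]. *)
Definition S_beta : operator := fun f => @PS_decr_1 C_AbsRing C_NormedModule f.

Lemma S_beta_eval (f : nat -> C) (z y : C) : z <> 0%C ->
  @is_pseries C_AbsRing C_NormedModule f z y ->
  @is_pseries C_AbsRing C_NormedModule (S_beta f) z ((y - f 0%nat) / z)%C.
Proof.
intros Hz Hy.
assert (E : ((y - f 0%nat) / z)%C
  = @scal C_AbsRing C_NormedModule (/ z)%C (plus y (opp (f 0%nat)))).
{ change ((y - f 0%nat) / z = / z * (y + - f 0%nat))%C. field. exact Hz. }
rewrite E. apply (@is_pseries_decr_1 C_AbsRing C_NormedModule f z (/ z)%C y).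
- change (/ z * z = 1)%C. field. exact Hz.
- exact Hy.
Qed.

(* A bundle over the disk is given by its fibres, which are subspaces of
   [H2 beta]; all the bundles here carry the metric and the holomorphic
   structure induced by [H2 beta], and similarity only refers to the fibres. *)
Definition bundle : Type := C -> (nat -> C) -> Prop.

Definition ker_bundle (beta : nat -> R) (T : operator) : bundle :=
  fun omega f => H2 beta f /\ forall k, (T f k - omega * f k)%C = 0%C.

Definition similar (beta : nat -> R) (E E' : bundle) : Prop :=
  exists X : operator, bounded_invertible beta X /\
    forall omega, unit_disk omega ->
      forall g, E' omega g <-> exists f, E omega f /\ g = X f.

Lemma moebius_den_neq0 (z0 z : C) : unit_disk z0 -> unit_disk z ->
  (1 - Cconj z0 * z)%C <> 0%C.
Proof.
unfold unit_disk; intros H0 Hz E.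
assert (E1 : (Cconj z0 * z)%C = 1%C).
{ replace (Cconj z0 * z)%C with (1 - (1 - Cconj z0 * z))%C by ring.
  rewrite E; ring. }
assert (E2 : Cmod z0 * Cmod z = 1).
{ rewrite <- (Cmod_conj z0), <- Cmod_mult, E1. apply Cmod_1. }
assert (P0 := Cmod_ge_0 z0). assert (P := Cmod_ge_0 z). nra.
Qed.

Lemma Cmod_sqr_parts (z : C) : Cmod z ^ 2 = fst z ^ 2 + snd z ^ 2.
Proof. unfold Cmod. apply pow2_sqrt. nra. Qed.

Lemma Cmod_cis (theta : R) : Cmod (cos theta, sin theta) = 1.
Proof.
assert (E := Cmod_sqr_parts (cos theta, sin theta)); simpl fst in E; simpl snd in E.
assert (F := sin2_cos2 theta); unfold Rsqr in F.
assert (P := Cmod_ge_0 (cos theta, sin theta)). nra.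
Qed.

Lemma moebius_disk (theta : R) (z0 z : C) : unit_disk z0 -> unit_disk z ->
  unit_disk (moebius theta z0 z).
Proof.
intros H0 Hz. assert (D := moebius_den_neq0 z0 z H0 Hz).
unfold unit_disk, moebius in *.
rewrite Cmod_mult, Cmod_cis, Rmult_1_l, Cmod_div by exact D.
assert (Q := proj1 (Cmod_gt_0 _) D).
apply (Rmult_lt_reg_r (Cmod (1 - Cconj z0 * z))); [exact Q|].
unfold Rdiv; rewrite Rmult_assoc, Rinv_l, Rmult_1_r, Rmult_1_l by lra.
apply Rsqr_incrst_0; [|apply Cmod_ge_0|lra].
rewrite !Rsqr_pow2, !Cmod_sqr_parts.
assert (A0 := Cmod_sqr_parts z0). assert (A := Cmod_sqr_parts z).
assert (P0 := Cmod_ge_0 z0). assert (P := Cmod_ge_0 z).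
destruct z0 as [a b], z as [x y]; simpl in A0, A |- *.
assert (B0 : 0 < 1 - (a * (a * 1) + b * (b * 1))) by nra.
assert (B : 0 < 1 - (x * (x * 1) + y * (y * 1))) by nra.
assert (B1 := Rmult_lt_0_compat _ _ B0 B). ring_simplify in B1. ring_simplify. lra.
Qed.

Lemma moebius_inverse (theta : R) (z0 z : C) : unit_disk z0 -> unit_disk z ->
  let w0 := ((cos theta, sin theta) * z0)%C in
  moebius (- theta) w0 (moebius theta z0 z) = z /\
  moebius theta z0 (moebius (- theta) w0 z) = z.
Proof.
intros H0 Hz w0.
assert (Hw : unit_disk w0).
{ unfold unit_disk, w0. rewrite Cmod_mult, Cmod_cis, Rmult_1_l. exact H0. }
assert (D1 := moebius_den_neq0 z0 z H0 Hz).
assert (D2 := moebius_den_neq0 _ _ Hw (moebius_disk theta z0 z H0 Hz)).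
assert (D3 := moebius_den_neq0 w0 z Hw Hz).
assert (D4 := moebius_den_neq0 _ _ H0 (moebius_disk (- theta) w0 z Hw Hz)).
assert (D5 := moebius_den_neq0 z0 z0 H0 H0).
assert (U : ((cos theta, sin theta) * (cos (- theta), sin (- theta)) = 1)%C).
{ rewrite cos_neg, sin_neg. assert (F := sin2_cos2 theta); unfold Rsqr in F.
  apply injective_projections; simpl; lra. }
assert (V : Cconj w0 = ((cos (- theta), sin (- theta)) * Cconj z0)%C).
{ unfold w0. rewrite cos_neg, sin_neg. destruct z0.
  apply injective_projections; simpl; ring. }
unfold moebius in *. rewrite V in *. unfold w0 in *. clear V w0 Hw.
set (u := (cos theta, sin theta) : C) in *.
set (v := (cos (- theta), sin (- theta)) : C) in *.
set (c := Cconj z0) in *. clearbody u v c.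
assert (Nu : u <> 0%C).
{ intro E; rewrite E, Cmult_0_l in U. apply C1_nz; now symmetry. }
assert (Ev : v = (/ u)%C).
{ replace v with (/ u * (u * v))%C by (field; exact Nu). rewrite U. field; exact Nu. }
subst v. split.
- replace (1 - / u * c * (u * ((z0 - z) / (1 - c * z))))%C
    with ((1 - c * z0) / (1 - c * z))%C by (field; auto).
  field. auto.
- assert (D6 : (u - c * z)%C <> 0%C).
  { intro E. apply D3. replace (1 - / u * c * z)%C with (/ u * (u - c * z))%C
      by (field; exact Nu). rewrite E; ring. }
  replace (1 - c * (/ u * ((u * z0 - z) / (1 - / u * c * z))))%C
    with (u * (1 - c * z0) / (u - c * z))%C by (field; auto).
  field. auto.
Qed.

Lemma Aut_disk_bijection (phi : C -> C) : Aut_disk phi ->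
  (forall z, unit_disk z -> unit_disk (phi z)) /\
  (forall w, unit_disk w -> exists! z, unit_disk z /\ phi z = w).
Proof.
intros [theta [z0 [H0 E]]]. split.
- intros z Hz; rewrite E; now apply moebius_disk.
- intros w Hw.
  assert (Hw0 : unit_disk ((cos theta, sin theta) * z0)%C).
  { unfold unit_disk. rewrite Cmod_mult, Cmod_cis, Rmult_1_l. exact H0. }
  exists (moebius (- theta) ((cos theta, sin theta) * z0)%C w). split; [split|].
  + now apply moebius_disk.
  + rewrite E. now apply moebius_inverse.
  + intros z [Hz Ez]. rewrite <- Ez, E. now apply moebius_inverse.
Qed.

(* Main.v *)
(* A composition operator with a disk automorphism is moved by transposition to an
   operator [X] on the weighted space itself: if [psi = phi^(-1)], then [X] sends the
   kernel [k_w = (w^k)_k], which spans [Ker (S_beta - w)], to [k_(psi w)], which spans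
   [Ker (phi (S_beta) - w)].  The entry [(k, j)] of its matrix is the coefficient of
   [z^j] in [psi^k], so only its boundedness is at stake.  Up to diagonal unitaries,
   [psi] is [psi_s z = (z + s) / (1 + s z)] with [s] real.  On finite sequences [X_s f]
   solves the ODE [F_k' = k (F_(k-1) - F_(k+1)) / (1 - s^2)], and summation by parts gives
   [d/ds sum beta_k^2 F_k^2 = 2 / (1 - s^2) * sum ((k+1) beta_(k+1)^2 - k beta_k^2) F_k F_(k+1)].
   Polynomial growth says precisely that the bracket is [O (beta_k beta_(k+1))], so
   Gronwall's lemma bounds [X_s].  The functional calculus is made explicit as
   [phi (S_beta) = e^(i theta) (z0 - S_beta) (1 - conj(z0) S_beta)^(-1)]. *)
Require Import Defs.
From Stdlib Require Import Reals Lra Lia FunctionalExtensionality.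
From Coquelicot Require Import Coquelicot.

Open Scope R_scope.

(** * Series and the weighted space *)

(** Gronwall's lemma can only be applied to truncated energies, and cutting the infinite system at
    index [N] leaves the term [N beta_N^2 F_N F_(N+1)], which the energy does not control with a
    constant independent of [N]. For finite data a Cauchy estimate for [psi^k] on a small circle
    makes [F_k] decay geometrically, so this term vanishes as [N] grows. No power series are
    multiplied. All algebra of [X] comes from [(1 + s z) psi^(k+1) = (z + s) psi^k], which
    transposes to [S X (1 + s S) = X (S + s)]. The operator [phiS] is only known through a contour
    of unspecified radius [r]. That [1] lies in the spectrum forces [r > 1]; holomorphy forces the
    pole outside the circle. The integral is then computed by writing [f = (1 - conj(z0) S) u],
    which cancels the denominator of [phi]. [S_beta] need not be a contraction, so its Neumann
    series is controlled through an equivalent weight in which its squared norm is at most some [q]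
    close to [1]. *)

Lemma sum_n_S (a : nat -> R) (n : nat) : sum_n a (S n) = sum_n a n + a (S n).
Proof. exact (sum_Sn a n). Qed.

Lemma sum_n_zero (a : nat -> R) : sum_n a 0 = a 0%nat.
Proof. exact (sum_O a). Qed.

Lemma sum_n_incr (a : nat -> R) : (forall n, 0 <= a n) ->
  forall n, sum_n a n <= sum_n a (S n).
Proof. intros H n. rewrite sum_n_S. specialize (H (S n)). lra. Qed.

Lemma sum_n_nonneg (a : nat -> R) (n : nat) : (forall k, 0 <= a k) -> 0 <= sum_n a n.
Proof.
intro H. induction n as [|n IH]; [rewrite sum_n_zero; apply H|].
rewrite sum_n_S. specialize (H (S n)). lra.
Qed.

Lemma nonneg_series_bounded (a : nat -> R) (M : R) : (forall n, 0 <= a n) ->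
  (forall n, sum_n a n <= M) -> ex_series a /\ Series a <= M.
Proof.
intros H0 H.
assert (E : ex_series a).
{ destruct (ex_finite_lim_seq_incr (sum_n a) M (sum_n_incr a H0) H) as [l Hl].
  exists l. exact Hl. }
split; [exact E|].
exact (is_lim_seq_le (sum_n a) (fun _ => M) (Series a) M H
  (Series_correct _ E) (is_lim_seq_const M)).
Qed.

Lemma sum_n_le_Series (a : nat -> R) : (forall n, 0 <= a n) -> ex_series a ->
  forall n, sum_n a n <= Series a.
Proof.
intros H0 E. apply (is_lim_seq_incr_compare (sum_n a) (Series a)).
- exact (Series_correct _ E).
- now apply sum_n_incr.
Qed.

Lemma term_le_sum_n (a : nat -> R) (n : nat) : (forall k, 0 <= a k) -> a n <= sum_n a n.
Proof.
intro H. destruct n; [rewrite sum_n_zero; lra|].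
rewrite sum_n_S. assert (P := sum_n_nonneg a n H). lra.
Qed.

Lemma term_le_Series (a : nat -> R) (n : nat) : (forall k, 0 <= a k) -> ex_series a ->
  a n <= Series a.
Proof.
intros H E. apply Rle_trans with (sum_n a n);
  [now apply term_le_sum_n | now apply sum_n_le_Series].
Qed.

Lemma Series_nonneg (a : nat -> R) : (forall n, 0 <= a n) -> ex_series a -> 0 <= Series a.
Proof. intros H E. apply Rle_trans with (a 0%nat); [apply H | now apply term_le_Series]. Qed.

Lemma ex_series_nonneg_le (a b : nat -> R) : (forall n, 0 <= a n <= b n) ->
  ex_series b -> ex_series a.
Proof.
intros H E. apply (@ex_series_le R_AbsRing R_CompleteNormedModule a b); [|exact E].
intro n. change (Rabs (a n) <= b n). rewrite Rabs_pos_eq; apply H.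
Qed.

(** * Absolutely summable complex series *)

Definition csummable (h : nat -> C) : Prop := ex_series (fun n => Cmod (h n)).

Definition CSeries (h : nat -> C) : C :=
  (Series (fun n => Re (h n)), Series (fun n => Im (h n))).

Lemma Cmod_Ci : Cmod Ci = 1.
Proof. unfold Cmod, Ci; simpl. transitivity (sqrt 1); [f_equal; ring|apply sqrt_1]. Qed.

Lemma im_le_Cmod (z : C) : Rabs (Im z) <= Cmod z.
Proof.
replace (Im z) with (- Re (Ci * z)%C) by (destruct z; unfold Re, Im, Ci; simpl; ring).
rewrite Rabs_Ropp.
apply Rle_trans with (1 := re_le_Cmod _).
rewrite Cmod_mult, Cmod_Ci. lra.
Qed.

Lemma Cmod_le_parts (z : C) : Cmod z <= Rabs (Re z) + Rabs (Im z).
Proof.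
assert (A := Cmod_sqr_parts z). assert (P := Cmod_ge_0 z).
unfold Re, Im. assert (P1 := Rabs_pos (fst z)). assert (P2 := Rabs_pos (snd z)).
assert (E1 := pow2_abs (fst z)). assert (E2 := pow2_abs (snd z)). nra.
Qed.

Lemma csummable_Re (h : nat -> C) : csummable h -> ex_series (fun n => Re (h n)).
Proof.
intro H. apply (@ex_series_le R_AbsRing R_CompleteNormedModule) with (2 := H).
intro n. apply re_le_Cmod.
Qed.

Lemma csummable_Im (h : nat -> C) : csummable h -> ex_series (fun n => Im (h n)).
Proof.
intro H. apply (@ex_series_le R_AbsRing R_CompleteNormedModule) with (2 := H).
intro n. apply im_le_Cmod.
Qed.

Lemma csummable_le (h : nat -> C) (b : nat -> R) : (forall n, Cmod (h n) <= b n) ->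
  ex_series b -> csummable h.
Proof.
intros H. apply ex_series_nonneg_le. intro n. split; [apply Cmod_ge_0|apply H].
Qed.

(** The real and imaginary parts are bounded separately, at the price of a factor [2] that no later
    estimate is sensitive to. *)
Lemma CSeries_bound (h : nat -> C) (b : nat -> R) : (forall n, Cmod (h n) <= b n) ->
  ex_series b -> Cmod (CSeries h) <= 2 * Series b.
Proof.
intros H E.
assert (A : forall u : nat -> R, (forall n, Rabs (u n) <= Cmod (h n)) ->
  Rabs (Series u) <= Series b).
{ intros u Hu.
  assert (E1 : ex_series (fun n => Rabs (u n))).
  { apply ex_series_nonneg_le with (2 := E). intro n.
    split; [apply Rabs_pos|]. specialize (Hu n). specialize (H n). lra. }
  apply Rle_trans with (1 := Series_Rabs u E1).
  apply Series_le; [|exact E]. intro n. split; [apply Rabs_pos|].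
  specialize (Hu n). specialize (H n). lra. }
apply Rle_trans with (1 := Cmod_le_parts _).
assert (B1 := A (fun n => Re (h n)) (fun n => re_le_Cmod _)).
assert (B2 := A (fun n => Im (h n)) (fun n => im_le_Cmod _)).
unfold CSeries, Re at 1, Im at 1. simpl. lra.
Qed.

Lemma CSeries_lin (a b : C) (h g : nat -> C) : csummable h -> csummable g ->
  CSeries (fun n => a * h n + b * g n)%C = (a * CSeries h + b * CSeries g)%C.
Proof.
intros Hh Hg.
assert (R1 := csummable_Re _ Hh). assert (I1 := csummable_Im _ Hh).
assert (R2 := csummable_Re _ Hg). assert (I2 := csummable_Im _ Hg).
assert (L : forall (p q r s : R),
  Series (fun n => p * Re (h n) + q * Im (h n) + (r * Re (g n) + s * Im (g n)))
  = p * Series (fun n => Re (h n)) + q * Series (fun n => Im (h n))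
    + (r * Series (fun n => Re (g n)) + s * Series (fun n => Im (g n)))).
{ intros p q r s.
  rewrite !Series_plus, !Series_scal_l; try reflexivity;
    repeat (first [now apply (ex_series_scal_l (V := R_NormedModule))
      | apply (ex_series_plus (V := R_NormedModule))]). }
unfold CSeries. destruct a as [a1 a2], b as [b1 b2].
apply injective_projections; simpl.
- rewrite (Series_ext _ (fun n => a1 * Re (h n) + (- a2) * Im (h n)
    + (b1 * Re (g n) + (- b2) * Im (g n)))).
  + rewrite L. unfold Re, Im. ring.
  + intro n. unfold Re, Im. simpl. ring.
- rewrite (Series_ext _ (fun n => a2 * Re (h n) + a1 * Im (h n)
    + (b2 * Re (g n) + b1 * Im (g n)))).
  + rewrite L. unfold Re, Im. ring.
  + intro n. unfold Re, Im. simpl. ring.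
Qed.

Lemma CSeries_ext (h g : nat -> C) : (forall n, h n = g n) -> CSeries h = CSeries g.
Proof. intro H. unfold CSeries. f_equal; apply Series_ext; intro n; now rewrite H. Qed.

Lemma csummable_S (h : nat -> C) : csummable h -> csummable (fun n => h (S n)).
Proof. intro H. exact (proj1 (ex_series_incr_1 _) H). Qed.

Lemma CSeries_incr_1 (h : nat -> C) : csummable h ->
  CSeries h = (h 0%nat + CSeries (fun n => h (S n)))%C.
Proof.
intro H. unfold CSeries.
rewrite (Series_incr_1 _ (csummable_Re _ H)), (Series_incr_1 _ (csummable_Im _ H)).
reflexivity.
Qed.

Definition sqnorm (beta : nat -> R) (f : nat -> C) : R :=
  Series (fun k => Cmod (f k) ^ 2 * beta k ^ 2).

Lemma sqterm_nonneg (beta : nat -> R) (f : nat -> C) (k : nat) :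
  0 <= Cmod (f k) ^ 2 * beta k ^ 2.
Proof. apply Rmult_le_pos; apply pow2_ge_0. Qed.

Lemma sqnorm_nonneg (beta : nat -> R) (f : nat -> C) : H2 beta f -> 0 <= sqnorm beta f.
Proof. apply Series_nonneg. apply sqterm_nonneg. Qed.

Lemma term_le_sqnorm (beta : nat -> R) (f : nat -> C) (k : nat) : H2 beta f ->
  Cmod (f k) ^ 2 * beta k ^ 2 <= sqnorm beta f.
Proof.
apply (term_le_Series (fun k => Cmod (f k) ^ 2 * beta k ^ 2)). apply sqterm_nonneg.
Qed.

Lemma norm2_sqnorm (beta : nat -> R) (f : nat -> C) : norm2 beta f = sqrt (sqnorm beta f).
Proof.
unfold norm2, sqnorm. f_equal. unfold inner. simpl. apply Series_ext. intro k.
change (beta k ^ 2 * Re (f k * Cconj (f k)) = Cmod (f k) ^ 2 * beta k ^ 2).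
rewrite Cmod_sqr_parts. destruct (f k) as [x y]. simpl. ring.
Qed.

Lemma Cmod_lin_sqr (a b x y : C) :
  Cmod (a * x + b * y) ^ 2 <= 2 * Cmod a ^ 2 * Cmod x ^ 2 + 2 * Cmod b ^ 2 * Cmod y ^ 2.
Proof.
assert (T := Cmod_triangle (a * x) (b * y)). rewrite !Cmod_mult in T.
assert (P := Cmod_ge_0 (a * x + b * y)).
assert (Q := pow2_ge_0 (Cmod a * Cmod x - Cmod b * Cmod y)).
apply Rle_trans with ((Cmod a * Cmod x + Cmod b * Cmod y) ^ 2).
- apply pow_incr. lra.
- nra.
Qed.

Lemma H2_lin_sqnorm (beta : nat -> R) (a b : C) (f g : nat -> C) :
  H2 beta f -> H2 beta g ->
  H2 beta (fun k => a * f k + b * g k)%C /\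
  sqnorm beta (fun k => a * f k + b * g k)%C
    <= 2 * Cmod a ^ 2 * sqnorm beta f + 2 * Cmod b ^ 2 * sqnorm beta g.
Proof.
intros Hf Hg.
set (v := fun k => 2 * Cmod a ^ 2 * (Cmod (f k) ^ 2 * beta k ^ 2)
  + 2 * Cmod b ^ 2 * (Cmod (g k) ^ 2 * beta k ^ 2)).
assert (V1 : ex_series (fun k => 2 * Cmod a ^ 2 * (Cmod (f k) ^ 2 * beta k ^ 2)))
  by now apply (ex_series_scal_l (V := R_NormedModule)).
assert (V2 : ex_series (fun k => 2 * Cmod b ^ 2 * (Cmod (g k) ^ 2 * beta k ^ 2)))
  by now apply (ex_series_scal_l (V := R_NormedModule)).
assert (V : ex_series v) by exact (ex_series_plus _ _ V1 V2).
assert (L : forall k, 0 <= Cmod (a * f k + b * g k) ^ 2 * beta k ^ 2 <= v k).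
{ intro k. split; [apply Rmult_le_pos; apply pow2_ge_0|].
  assert (Q := Cmod_lin_sqr a b (f k) (g k)). assert (B := pow2_ge_0 (beta k)).
  unfold v. nra. }
split.
- exact (ex_series_nonneg_le _ _ L V).
- apply Rle_trans with (Series v); [exact (Series_le _ _ L V)|].
  unfold v. rewrite Series_plus, !Series_scal_l by assumption. apply Rle_refl.
Qed.

Lemma H2_lin (beta : nat -> R) (a b : C) (f g : nat -> C) :
  H2 beta f -> H2 beta g -> H2 beta (fun k => a * f k + b * g k)%C.
Proof. intros Hf Hg. now apply H2_lin_sqnorm. Qed.

Lemma H2_scal (beta : nat -> R) (a : C) (f : nat -> C) :
  H2 beta f -> H2 beta (fun k => a * f k)%C.
Proof.
intro Hf. generalize (H2_lin beta a 0 f f Hf Hf). apply ex_series_ext.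
intro k. do 2 f_equal. f_equal. ring.
Qed.

Lemma sqnorm_scal (beta : nat -> R) (a : C) (f : nat -> C) :
  sqnorm beta (fun k => a * f k)%C = Cmod a ^ 2 * sqnorm beta f.
Proof.
unfold sqnorm. rewrite <- Series_scal_l. apply Series_ext. intro k.
rewrite Cmod_mult. ring.
Qed.

Lemma sqnorm_zero (beta : nat -> R) (f : nat -> C) : (forall k, 0 < beta k) ->
  H2 beta f -> sqnorm beta f <= 0 -> forall k, f k = 0%C.
Proof.
intros Hb Hf H k. assert (T := term_le_sqnorm beta f k Hf).
apply Cmod_eq_0. assert (P := Cmod_ge_0 (f k)). specialize (Hb k).
assert (B : 0 < beta k ^ 2) by now apply pow_lt.
destruct P as [P|P]; [|now symmetry].
assert (Q := Rmult_lt_0_compat _ _ (pow_lt _ 2 P) B). lra.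
Qed.

Definition linear_on (beta : nat -> R) (T : operator) : Prop :=
  forall (a b : C) f g, H2 beta f -> H2 beta g ->
     T (fun k => a * f k + b * g k)%C = (fun k => a * T f k + b * T g k)%C.

(** A bound on partial sums yields membership of [T f] in the space and the norm estimate together,
    so convergence of the image need not be known first. The sign of [M] is unknown, hence
    [Rmax 0 M] under the root. *)
Lemma bounded_operator_partial_sums (beta : nat -> R) (T : operator) (M : R) :
  linear_on beta T ->
  (forall f n, H2 beta f ->
     sum_n (fun k => Cmod (T f k) ^ 2 * beta k ^ 2) n <= M * sqnorm beta f) ->
  bounded_operator beta T /\
  forall f, H2 beta f -> sqnorm beta (T f) <= M * sqnorm beta f.
Proof.
intros L H.
assert (A : forall f, H2 beta f -> H2 beta (T f) /\ sqnorm beta (T f) <= M * sqnorm beta f).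
{ intros f Hf. apply nonneg_series_bounded; [apply sqterm_nonneg|].
  intro n. now apply H. }
split; [split; [|split]|].
- intros f Hf. now apply A.
- exact L.
- exists (sqrt (Rmax 0 M)). intros f Hf. rewrite !norm2_sqnorm, <- sqrt_mult_alt
    by apply Rmax_l.
  apply sqrt_le_1_alt. apply Rle_trans with (1 := proj2 (A f Hf)).
  apply Rmult_le_compat_r; [now apply sqnorm_nonneg|apply Rmax_r].
- intros f Hf. now apply A.
Qed.

Lemma bounded_operator_comp (beta : nat -> R) (T U : operator) :
  bounded_operator beta T -> bounded_operator beta U ->
  bounded_operator beta (fun f => T (U f)).
Proof.
intros [T1 [T2 [MT T3]]] [U1 [U2 [MU U3]]]. split; [|split].
- auto.
- intros a b f g Hf Hg. rewrite U2, T2; auto.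
- exists (Rmax 0 MT * MU). intros f Hf.
  assert (P : 0 <= norm2 beta (U f)) by apply sqrt_pos.
  apply Rle_trans with (1 := T3 _ (U1 _ Hf)).
  apply Rle_trans with (Rmax 0 MT * norm2 beta (U f)).
  + apply Rmult_le_compat_r; [exact P|apply Rmax_r].
  + rewrite Rmult_assoc. apply Rmult_le_compat_l; [apply Rmax_l|now apply U3].
Qed.

Lemma bounded_operator_lin (beta : nat -> R) (T U : operator) (a b : C) :
  bounded_operator beta T -> bounded_operator beta U ->
  bounded_operator beta (fun f k => a * T f k + b * U f k)%C.
Proof.
intros [T1 [T2 [MT T3]]] [U1 [U2 [MU U3]]]. split; [|split].
- intros f Hf. apply H2_lin; auto.
- intros c d f g Hf Hg. apply functional_extensionality. intro k.
  rewrite T2, U2 by assumption. ring.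
- exists (sqrt (2 * Cmod a ^ 2 * MT ^ 2 + 2 * Cmod b ^ 2 * MU ^ 2)). intros f Hf.
  specialize (T3 f Hf). specialize (U3 f Hf). specialize (T1 f Hf). specialize (U1 f Hf).
  rewrite !norm2_sqnorm in *.
  assert (N := sqnorm_nonneg _ _ Hf).
  assert (S : forall x M, 0 <= x -> sqrt x <= M * sqrt (sqnorm beta f) ->
    x <= M ^ 2 * sqnorm beta f).
  { intros x M Hx Hs. rewrite <- (pow2_sqrt x Hx), <- (pow2_sqrt _ N), <- Rpow_mult_distr.
    apply pow_incr. split; [apply sqrt_pos|]. exact Hs. }
  apply S in T3; [|now apply sqnorm_nonneg]. apply S in U3; [|now apply sqnorm_nonneg].
  assert (Qa := pow2_ge_0 (Cmod a)). assert (Qb := pow2_ge_0 (Cmod b)).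
  assert (Qt := Rmult_le_pos _ _ Qa (pow2_ge_0 MT)).
  assert (Qu := Rmult_le_pos _ _ Qb (pow2_ge_0 MU)).
  rewrite <- sqrt_mult_alt by lra. apply sqrt_le_1_alt.
  apply Rle_trans with (1 := proj2 (H2_lin_sqnorm beta a b _ _ T1 U1)).
  apply Rmult_le_compat_l with (1 := Qa) in T3.
  apply Rmult_le_compat_l with (1 := Qb) in U3. lra.
Qed.

(** * Weights, the backward shift and its Neumann series *)

Lemma ratio_lim (beta : nat -> R) : admissible_weight beta ->
  is_lim_seq (fun k => beta (S k) / beta k) 1.
Proof. intros [_ [_ H]]. exact (proj1 (is_lim_seq_incr_1 _ _) H). Qed.

(** The reciprocal weight enters twice: as the dual weight when a row of the matrix is paired with
    an element of the space, and to get the limit of [beta k / beta (S k)]. *)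
Lemma admissible_inv (beta : nat -> R) : admissible_weight beta ->
  admissible_weight (fun k => / beta k).
Proof.
intros [Hp [H0 Hl]]. split; [|split].
- intro k. apply Rinv_0_lt_compat, Hp.
- now rewrite H0, Rinv_1.
- apply is_lim_seq_ext with (fun k => / weight_ratio beta k).
  + intro k. unfold weight_ratio. rewrite Rinv_div. unfold Rdiv.
    rewrite Rinv_inv. ring.
  + replace (Finite 1) with (Rbar_inv 1) by (simpl; now rewrite Rinv_1).
    apply is_lim_seq_inv; [exact Hl|]. injection. lra.
Qed.

(** Ratio test. The factor [INR k + 1] is there because the boundary term of the energy estimate
    carries a factor [N]. *)
Lemma growth_summable (beta : nat -> R) (x : R) : admissible_weight beta -> 0 < x < 1 ->
  ex_series (fun k => (INR k + 1) * beta k ^ 2 * x ^ k).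
Proof.
intros H Hx. assert (Hp := proj1 H).
assert (P : forall k, 0 < (INR k + 1) * beta k ^ 2 * x ^ k).
{ intro k. apply Rmult_lt_0_compat; [|now apply pow_lt].
  apply Rmult_lt_0_compat; [|apply pow_lt, Hp].
  assert (Q := pos_INR k). lra. }
apply ex_series_ext with (fun k => Rabs ((INR k + 1) * beta k ^ 2 * x ^ k)).
- intro k. apply Rabs_pos_eq, Rlt_le, P.
- apply (ex_series_DAlembert (fun k => (INR k + 1) * beta k ^ 2 * x ^ k) x); [lra| |].
  + intro n. apply Rgt_not_eq, P.
  + apply is_lim_seq_ext with
      (fun k => (1 + / (INR k + 1)) * (beta (S k) / beta k) * (beta (S k) / beta k) * x).
    * intro k. rewrite Rabs_pos_eq
        by (apply Rlt_le, Rdiv_lt_0_compat; apply P).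
      rewrite S_INR. assert (Q := pos_INR k). assert (B := Hp k). simpl pow.
      assert (X : x ^ k <> 0) by (apply pow_nonzero; lra).
      field. repeat split; try lra; try exact X.
    * replace (Finite x) with (Finite ((1 + 0) * 1 * 1 * x)) by (f_equal; ring).
      repeat apply is_lim_seq_mult'; try apply (ratio_lim beta H);
        [|apply is_lim_seq_const].
      apply is_lim_seq_plus'; [apply is_lim_seq_const|].
      apply is_lim_seq_ext with (fun k => / INR (S k)).
      -- intro k. now rewrite S_INR.
      -- apply (is_lim_seq_incr_1 (fun k => / INR k)).
         replace (Finite 0) with (Rbar_inv p_infty) by reflexivity.
         apply is_lim_seq_inv; [apply is_lim_seq_INR|]. discriminate.
Qed.

Lemma weight_summable (beta : nat -> R) (x : R) : admissible_weight beta -> 0 <= x < 1 ->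
  ex_series (fun k => beta k ^ 2 * x ^ k).
Proof.
(* The ratio test needs a positive ratio, so the case [x = 0] is reached through a larger [y]. *)
intros H Hx. set (y := (1 + x) / 2).
assert (Hy : 0 < y < 1) by (unfold y; lra).
apply ex_series_nonneg_le with (2 := growth_summable beta y H Hy).
intro k. assert (P := pow_lt _ 2 (proj1 H k)). assert (Q := pos_INR k).
assert (X := pow_le x k (proj1 Hx)).
assert (Y : x ^ k <= y ^ k) by (apply pow_incr; unfold y; lra).
split; [nra|]. rewrite Rmult_assoc.
assert (Z : beta k ^ 2 * x ^ k <= beta k ^ 2 * y ^ k) by (apply Rmult_le_compat_l; lra).
assert (W : 0 <= beta k ^ 2 * y ^ k) by nra. nra.
Qed.

Fixpoint weight_correction (beta : nat -> R) (q : R) (k : nat) : R :=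
  match k with
  | O => 1
  | S k => weight_correction beta q k * Rmax 1 (beta k ^ 2 / (q * beta (S k) ^ 2))
  end.

(* An equivalent weight for which the backward shift has squared norm at most [q]. *)
Definition weight' (beta : nat -> R) (q : R) (k : nat) : R :=
  beta k ^ 2 * weight_correction beta q k.

Lemma weight_correction_ge_1 (beta : nat -> R) (q : R) (k : nat) :
  1 <= weight_correction beta q k.
Proof.
induction k as [|k IH]; simpl; [lra|].
assert (P := Rmax_l 1 (beta k ^ 2 / (q * beta (S k) ^ 2))). simpl in P. nra.
Qed.

Lemma weight'_ge (beta : nat -> R) (q : R) (k : nat) : beta k ^ 2 <= weight' beta q k.
Proof.
unfold weight'. assert (P := weight_correction_ge_1 beta q k).
assert (Q := pow2_ge_0 (beta k)). nra.
Qed.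

(** The quotient inside [Rmax] tends to [/ q < 1], so the correction factor stops growing after
    finitely many indices and stays below its value there. *)
Lemma weight'_le (beta : nat -> R) (q : R) : admissible_weight beta -> 1 < q ->
  exists P, 0 < P /\ forall k, weight' beta q k <= P * beta k ^ 2.
Proof.
intros H Hq. assert (Hp := proj1 H).
assert (E : exists N, forall k, (N <= k)%nat -> beta k ^ 2 / (q * beta (S k) ^ 2) <= 1).
{ assert (L : is_lim_seq (fun k => beta k ^ 2 / (q * beta (S k) ^ 2)) (/ q)).
  { apply is_lim_seq_ext with
      (fun k => / q * ((/ beta (S k) / / beta k) * (/ beta (S k) / / beta k))).
    - intro k. assert (B := Hp k). assert (B' := Hp (S k)). field. lra.
    - replace (Finite (/ q)) with (Finite (/ q * (1 * 1))) by (f_equal; ring).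
      apply is_lim_seq_mult'; [apply is_lim_seq_const|].
      apply is_lim_seq_mult'; exact (ratio_lim _ (admissible_inv _ H)). }
  apply is_lim_seq_spec in L.
  assert (Q : / q < 1) by (rewrite <- Rinv_1; apply Rinv_lt_contravar; lra).
  assert (d : 0 < 1 - / q) by lra.
  destruct (L (mkposreal _ d)) as [N HN]. exists N. intros k Hk.
  specialize (HN k Hk). simpl in HN |- *. apply Rabs_lt_between' in HN. lra. }
destruct E as [N HN].
assert (F : forall k, weight_correction beta q k <= weight_correction beta q N).
{ assert (mono : forall i j, weight_correction beta q i <= weight_correction beta q (j + i)).
  { intros i j. induction j as [|j IH]; [apply Rle_refl|].
    apply Rle_trans with (1 := IH). simpl weight_correction.
    assert (P := weight_correction_ge_1 beta q (j + i)).
    assert (P' := Rmax_l 1 (beta (j + i)%nat ^ 2 / (q * beta (S (j + i)) ^ 2))).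
    simpl in P' |- *. nra. }
  intro k. destruct (Nat.le_ge_cases k N) as [L|L].
  - replace N with ((N - k) + k)%nat at 1 by lia. apply mono.
  - replace k with ((k - N) + N)%nat by lia.
    induction (k - N)%nat as [|j IH]; [apply Rle_refl|].
    simpl Nat.add. simpl weight_correction. rewrite Rmax_left; [lra|].
    apply HN. lia. }
exists (weight_correction beta q N). split.
- assert (P := weight_correction_ge_1 beta q N). lra.
- intro k. unfold weight'. rewrite Rmult_comm.
  apply Rmult_le_compat_r; [apply pow2_ge_0|apply F].
Qed.

Lemma weight'_step (beta : nat -> R) (q : R) (k : nat) : (forall k, 0 < beta k) -> 0 < q ->
  weight' beta q k <= q * weight' beta q (S k).
Proof.
intros Hp Hq. unfold weight'. simpl weight_correction.
assert (P := weight_correction_ge_1 beta q k).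
assert (M := Rmax_r 1 (beta k ^ 2 / (q * beta (S k) ^ 2))).
assert (B := pow_lt _ 2 (Hp (S k))).
set (m := Rmax _ _) in *. set (w := weight_correction _ _ _) in *.
apply Rle_trans with
  ((q * beta (S k) ^ 2 * w) * (beta k ^ 2 / (q * beta (S k) ^ 2))).
- right. field. split; [apply Rgt_not_eq, Hp|lra].
- apply Rle_trans with (q * beta (S k) ^ 2 * w * m); [|right; ring].
  apply Rmult_le_compat_l; [|exact M].
  assert (0 < q * beta (S k) ^ 2) by now apply Rmult_lt_0_compat. nra.
Qed.

Lemma weight'_pos (beta : nat -> R) (q : R) (k : nat) : (forall k, 0 < beta k) ->
  0 < weight' beta q k.
Proof.
intro Hp. assert (B := pow_lt _ 2 (Hp k)). assert (W := weight'_ge beta q k). lra.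
Qed.

Lemma weight'_steps (beta : nat -> R) (q : R) (k n : nat) : (forall k, 0 < beta k) -> 0 < q ->
  weight' beta q k <= q ^ n * weight' beta q (k + n).
Proof.
intros Hp Hq. revert k. induction n as [|n IH]; intro k.
- rewrite Nat.add_0_r. simpl. lra.
- apply Rle_trans with (1 := weight'_step beta q k Hp Hq).
  replace (k + S n)%nat with (S k + n)%nat by lia. simpl pow. rewrite Rmult_assoc.
  apply Rmult_le_compat_l; [lra|apply IH].
Qed.

Definition shift (n : nat) : operator := fun f k => f (k + n)%nat.

(** For every [q > 1] the powers of the shift satisfy [||S^n||^2 <= P q^n]: the spectral radius is
    at most [1], in a quantitative form. The constant [P] is the cost of passing to [weight'] and
    back. *)
Lemma shift_sqnorm (beta : nat -> R) (q : R) : admissible_weight beta -> 1 < q ->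
  exists P, forall n f, H2 beta f ->
    H2 beta (shift n f) /\ sqnorm beta (shift n f) <= P * q ^ n * sqnorm beta f.
Proof.
intros H Hq. assert (Hp := proj1 H).
destruct (weight'_le beta q H Hq) as [P [P0 HP]]. exists P. intros n f Hf.
assert (Hn : ex_series (fun k => Cmod (f (n + k)%nat) ^ 2 * beta (n + k)%nat ^ 2)).
{ exact (proj1 (ex_series_incr_n (fun k => Cmod (f k) ^ 2 * beta k ^ 2) n) Hf). }
set (v := fun k => P * q ^ n * (Cmod (f (n + k)%nat) ^ 2 * beta (n + k)%nat ^ 2)).
assert (V : ex_series v) by now apply (ex_series_scal_l (V := R_NormedModule)).
assert (L : forall k, 0 <= Cmod (shift n f k) ^ 2 * beta k ^ 2 <= v k).
{ intro k. split; [apply sqterm_nonneg|]. unfold v, shift.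
  rewrite (Nat.add_comm n k).
  apply Rle_trans with (Cmod (f (k + n)%nat) ^ 2 * (q ^ n * (P * beta (k + n)%nat ^ 2)));
    [|right; ring].
  apply Rmult_le_compat_l; [apply pow2_ge_0|].
  apply Rle_trans with (1 := weight'_ge beta q k).
  apply Rle_trans with (1 := weight'_steps beta q k n Hp ltac:(lra)).
  apply Rmult_le_compat_l; [apply pow_le; lra|apply HP]. }
split; [exact (ex_series_nonneg_le _ _ L V)|].
apply Rle_trans with (Series v); [exact (Series_le _ _ L V)|].
unfold v. rewrite Series_scal_l.
apply Rmult_le_compat_l; [apply Rmult_le_pos; [lra|apply pow_le; lra]|].
unfold sqnorm. destruct n as [|n]; [apply Rle_refl|].
rewrite (Series_incr_n (fun k => Cmod (f k) ^ 2 * beta k ^ 2) (S n)); [|lia|exact Hf].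
assert (S0 := sum_n_nonneg (fun k => Cmod (f k) ^ 2 * beta k ^ 2) n (sqterm_nonneg beta f)).
rewrite <- sum_n_Reals. simpl Nat.pred. lra.
Qed.

Lemma S_beta_bounded (beta : nat -> R) : admissible_weight beta ->
  bounded_operator beta S_beta.
Proof.
intro H. destruct (shift_sqnorm beta 2 H ltac:(lra)) as [P HP].
assert (E : forall f, S_beta f = shift 1 f).
{ intro f. apply functional_extensionality. intro k. unfold S_beta, PS_decr_1, shift.
  f_equal. lia. }
apply (bounded_operator_partial_sums beta S_beta (P * 2 ^ 1)).
- intros a b f g _ _. reflexivity.
- intros f n Hf. rewrite E. destruct (HP 1%nat f Hf) as [A B].
  apply Rle_trans with (2 := B). apply (sum_n_le_Series _ (sqterm_nonneg beta _) A).
Qed.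

Lemma H2_S (beta : nat -> R) (f : nat -> C) : admissible_weight beta -> H2 beta f ->
  H2 beta (S_beta f).
Proof. intro H. apply (S_beta_bounded beta H). Qed.

(* [neumann c] is [(1 - c S_beta)^(-1)]. *)
Definition neumann (c : C) : operator := fun f k => CSeries (fun n => c ^ n * f (k + n)%nat)%C.

(** Each step of the shift costs at most a factor [q] in [weight'], and each term of the norm series
    is at most its sum. The terms are thus geometric in [n], with the size in [k] governed by
    [weight']. *)
Lemma neumann_term_bound (beta : nat -> R) (q : R) : admissible_weight beta -> 1 < q ->
  exists P, 0 < P /\ forall c f k n, H2 beta f ->
    Cmod (c ^ n * f (k + n)%nat)
      <= sqrt (P * sqnorm beta f / weight' beta q k) * sqrt (Cmod c ^ 2 * q) ^ n.
Proof.
intros H Hq. assert (Hp := proj1 H).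
destruct (weight'_le beta q H Hq) as [P [P0 HP]]. exists P. split; [exact P0|].
intros c f k n Hf.
assert (W := weight'_pos beta q k Hp). assert (N := sqnorm_nonneg beta f Hf).
assert (D : 0 <= Cmod c ^ 2 * q) by (apply Rmult_le_pos; [apply pow2_ge_0|lra]).
assert (I : 0 <= P * sqnorm beta f / weight' beta q k)
  by (apply Rdiv_le_0_compat; [apply Rmult_le_pos; lra|exact W]).
apply Rsqr_incr_0_var;
  [|apply Rmult_le_pos; [apply sqrt_pos|apply pow_le, sqrt_pos]].
rewrite !Rsqr_pow2, Rpow_mult_distr, <- pow_mult, Nat.mul_comm, pow_mult, !pow2_sqrt by assumption.
rewrite Cmod_mult, Cmod_pow.
apply (Rmult_le_reg_r (weight' beta q k)); [exact W|].
replace (P * sqnorm beta f / weight' beta q k * (Cmod c ^ 2 * q) ^ n * weight' beta q k)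
  with (P * sqnorm beta f * (Cmod c ^ 2 * q) ^ n) by (field; lra).
rewrite !Rpow_mult_distr, <- !pow_mult, (Nat.mul_comm n 2).
apply Rle_trans with
  (Cmod c ^ (2 * n) * Cmod (f (k + n)%nat) ^ 2 * (q ^ n * (P * beta (k + n)%nat ^ 2))).
- apply Rmult_le_compat_l.
  + apply Rmult_le_pos; [apply pow_le, Cmod_ge_0|apply pow2_ge_0].
  + apply Rle_trans with (1 := weight'_steps beta q k n Hp ltac:(lra)).
    apply Rmult_le_compat_l; [apply pow_le; lra|apply HP].
- assert (T := term_le_sqnorm beta f (k + n) Hf).
  assert (X : 0 <= Cmod c ^ (2 * n) * q ^ n * P).
  { repeat apply Rmult_le_pos; [apply pow_le, Cmod_ge_0|apply pow_le; lra|lra]. }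
  apply Rmult_le_compat_l with (1 := X) in T. lra.
Qed.

Lemma neumann_summable (beta : nat -> R) (c : C) (f : nat -> C) (k : nat) :
  admissible_weight beta -> Cmod c < 1 -> H2 beta f ->
  csummable (fun n => c ^ n * f (k + n)%nat)%C.
Proof.
(* This [q] lies strictly between [1] and [/ Cmod c ^ 2], so that [Cmod c ^ 2 * q < 1]. *)
intros H Hc Hf. assert (C0 := Cmod_ge_0 c). set (q := 2 / (1 + Cmod c ^ 2)).
assert (C2 : 0 <= Cmod c ^ 2 < 1) by nra.
assert (Hq : 1 < q) by (apply Rlt_div_r; lra).
assert (D : 0 <= Cmod c ^ 2 * q < 1).
{ split; [apply Rmult_le_pos; lra|]. unfold q, Rdiv. rewrite <- Rmult_assoc.
  apply Rlt_div_l; lra. }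
destruct (neumann_term_bound beta q H Hq) as [P [_ HP]].
apply csummable_le with (1 := fun n => HP c f k n Hf).
apply (ex_series_scal_l (V := R_NormedModule)). apply ex_series_geom.
rewrite Rabs_pos_eq by apply sqrt_pos. rewrite <- sqrt_1. apply sqrt_lt_1; lra.
Qed.

Lemma neumann_rec (beta : nat -> R) (c : C) (f : nat -> C) (k : nat) :
  admissible_weight beta -> Cmod c < 1 -> H2 beta f ->
  neumann c f k = (f k + c * neumann c f (S k))%C.
Proof.
intros H Hc Hf. unfold neumann.
rewrite CSeries_incr_1 by (now apply (neumann_summable beta)).
rewrite Nat.add_0_r. simpl Cpow.
assert (B := neumann_summable beta c f (S k) H Hc Hf).
assert (L := CSeries_lin c 0 _ _ B B).
f_equal; [ring|].
transitivity (c * CSeries (fun n => c ^ n * f (S k + n)%nat)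
  + 0 * CSeries (fun n => c ^ n * f (S k + n)%nat))%C; [|ring].
rewrite <- L. apply CSeries_ext. intro n. replace (k + S n)%nat with (S k + n)%nat by lia.
ring.
Qed.

Lemma neumann_linear (beta : nat -> R) (c : C) : admissible_weight beta -> Cmod c < 1 ->
  linear_on beta (neumann c).
Proof.
intros H Hc a b f g Hf Hg. apply functional_extensionality. intro k. unfold neumann.
rewrite <- CSeries_lin by now apply (neumann_summable beta).
apply CSeries_ext. intro n. ring.
Qed.

(** Summing the one-step inequality shifts the index by one: [e 0] is dropped, being nonnegative,
    and [e (S n)] appears. For [kappa < 1] the sum can be absorbed on the left once [e (S n)] has an
    a priori bound. *)
Lemma sum_n_recursive_bound (e g : nat -> R) (kappa : R) : 0 <= kappa ->
  (forall k, 0 <= e k) -> (forall k, e k <= kappa * e (S k) + g k) ->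
  forall n, sum_n e n <= kappa * (sum_n e n + e (S n)) + sum_n g n.
Proof.
intros Hk He H n.
assert (A : sum_n e n <= kappa * (sum_n e n + e (S n) - e 0%nat) + sum_n g n).
{ induction n as [|n IH].
  - rewrite !sum_n_zero. specialize (H 0%nat). lra.
  - rewrite !sum_n_S. specialize (H (S n)). lra. }
specialize (He 0%nat). nra.
Qed.

Lemma sum_n_le (a b : nat -> R) (n : nat) : (forall k, a k <= b k) -> sum_n a n <= sum_n b n.
Proof.
intro H. induction n as [|n IH]; [rewrite !sum_n_zero; apply H|].
rewrite !sum_n_S. specialize (H (S n)). lra.
Qed.

Lemma sum_n_scal (c : R) (a : nat -> R) (n : nat) :
  sum_n (fun k => c * a k) n = c * sum_n a n.
Proof. exact (sum_n_mult_l c a n). Qed.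

(** The recursion [h_k = f_k + c h_(k+1)] for [h = neumann c f] contracts the energies
    [weight' k * |h_k|^2]. The constant [M] is chosen before [c], so one bound serves for a whole
    contour of resolvents. *)
Lemma neumann_bounded (beta : nat -> R) (a : R) : admissible_weight beta -> 0 <= a < 1 ->
  exists M, forall c, Cmod c <= a ->
    bounded_operator beta (neumann c) /\
    forall f, H2 beta f -> sqnorm beta (neumann c f) <= M * sqnorm beta f.
Proof.
intros H Ha. assert (Hp := proj1 H). set (q := 2 / (1 + a ^ 2)).
assert (A2 : 0 <= a ^ 2 < 1) by nra.
assert (Hq : 1 < q) by (apply Rlt_div_r; lra).
set (d := a ^ 2 * q).
assert (D : 0 <= d < 1).
{ split; [apply Rmult_le_pos; lra|]. unfold d, q, Rdiv. rewrite <- Rmult_assoc.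
  apply Rlt_div_l; lra. }
assert (D' : 0 <= sqrt d < 1).
{ split; [apply sqrt_pos|]. rewrite <- sqrt_1. apply sqrt_lt_1; lra. }
destruct (neumann_term_bound beta q H Hq) as [P [P0 HP]].
destruct (weight'_le beta q H Hq) as [P1 [P10 HP1]].
(* Here [kappa = d (3 - d) / 2], which is below [1] exactly because [(1 - d) (2 - d) > 0]. *)
set (eps := (1 - d) / 2). set (kappa := (1 + eps) * d).
assert (He : 0 < eps) by (unfold eps; lra).
assert (Hk : 0 <= kappa < 1) by (unfold kappa, eps; nra).
set (B := kappa * (4 * P / (1 - sqrt d) ^ 2) + (1 + / eps) * P1).
exists (B / (1 - kappa)). intros c Hc. assert (C0 := Cmod_ge_0 c).
assert (C1 : Cmod c < 1) by lra.
assert (C2 : Cmod c ^ 2 <= a ^ 2) by (apply pow_incr; lra).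
apply bounded_operator_partial_sums; [now apply neumann_linear|].
intros f n Hf. assert (N := sqnorm_nonneg beta f Hf).
set (e := fun k => weight' beta q k * Cmod (neumann c f k) ^ 2).
assert (E0 : forall k, 0 <= e k).
{ intro k. apply Rmult_le_pos; [apply Rlt_le, weight'_pos, Hp|apply pow2_ge_0]. }
(* The a priori bound, uniform in [k], that controls the boundary term [e (S n)]. *)
assert (Eb : forall k, e k <= 4 * P / (1 - sqrt d) ^ 2 * sqnorm beta f).
{ intro k. assert (W := weight'_pos beta q k Hp).
  set (G := sqrt (P * sqnorm beta f / weight' beta q k)).
  assert (G2 : G ^ 2 * weight' beta q k = P * sqnorm beta f).
  { unfold G. rewrite pow2_sqrt; [field; lra|].
    apply Rdiv_le_0_compat; [apply Rmult_le_pos; lra|exact W]. }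
  assert (T : forall m, Cmod (c ^ m * f (k + m)%nat) <= G * sqrt d ^ m).
  { intro m. apply Rle_trans with (1 := HP c f k m Hf).
    apply Rmult_le_compat_l; [apply sqrt_pos|]. apply pow_incr.
    split; [apply sqrt_pos|]. apply sqrt_le_1_alt. unfold d.
    apply Rmult_le_compat_r; lra. }
  assert (X : ex_series (fun m => G * sqrt d ^ m)).
  { apply (ex_series_scal_l (V := R_NormedModule)). apply ex_series_geom.
    rewrite Rabs_pos_eq; lra. }
  assert (Y := CSeries_bound _ _ T X). fold (neumann c f k) in Y.
  rewrite Series_scal_l, Series_geom in Y by (rewrite Rabs_pos_eq; lra).
  unfold e. apply Rle_trans with (weight' beta q k * (2 * (G * / (1 - sqrt d))) ^ 2).
  - apply Rmult_le_compat_l; [lra|]. apply pow_incr. split; [apply Cmod_ge_0|exact Y].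
  - right. replace (weight' beta q k * (2 * (G * / (1 - sqrt d))) ^ 2) with
      (4 * (G ^ 2 * weight' beta q k) / (1 - sqrt d) ^ 2) by (field; lra).
    rewrite G2. field. lra. }
assert (Es : forall k, e k <= kappa * e (S k)
    + (1 + / eps) * P1 * (Cmod (f k) ^ 2 * beta k ^ 2)).
{ intro k. unfold e.
  rewrite (neumann_rec beta c f k H C1 Hf).
  set (h := neumann c f (S k)).
  assert (Y : Cmod (f k + c * h) ^ 2
    <= (1 + eps) * (a ^ 2 * Cmod h ^ 2) + (1 + / eps) * Cmod (f k) ^ 2).
  { assert (T := Cmod_triangle (f k) (c * h)). rewrite Cmod_mult in T.
    assert (F0 := Cmod_ge_0 (f k)). assert (H0 := Cmod_ge_0 h).
    assert (S0 := Cmod_ge_0 (f k + c * h)).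
    set (x := Cmod (f k)) in *. set (y := Cmod h) in *.
    assert (Z : Cmod c * y <= a * y) by (apply Rmult_le_compat_r; lra).
    apply Rle_trans with ((x + a * y) ^ 2); [apply pow_incr; lra|].
    (* Young's inequality with parameter [eps], so that the coefficient of the next energy stays
       below [1]. *)
    assert (V := pow2_ge_0 (eps * (a * y) - x)).
    apply (Rmult_le_compat_l (/ eps)) in V; [|left; now apply Rinv_0_lt_compat].
    replace (/ eps * (eps * (a * y) - x) ^ 2) with
      (eps * (a * y) ^ 2 - 2 * (a * y) * x + / eps * x ^ 2) in V by (field; lra).
    lra. }
  assert (W := weight'_pos beta q k Hp).
  apply (Rmult_le_compat_l (weight' beta q k)) in Y; [|lra].
  apply Rle_trans with (1 := Y). rewrite Rmult_plus_distr_l.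
  apply Rplus_le_compat.
  - assert (W' := weight'_step beta q k Hp ltac:(lra)).
    assert (K : 0 <= (1 + eps) * (a ^ 2 * Cmod h ^ 2)).
    { apply Rmult_le_pos; [lra|]. apply Rmult_le_pos; [lra|apply pow2_ge_0]. }
    apply (Rmult_le_compat_r _ _ _ K) in W'. unfold kappa, d. lra.
  - assert (W' := HP1 k).
    assert (K : 0 <= (1 + / eps) * Cmod (f k) ^ 2).
    { apply Rmult_le_pos; [|apply pow2_ge_0].
      assert (I := Rinv_0_lt_compat _ He). lra. }
    apply (Rmult_le_compat_r _ _ _ K) in W'. lra. }
assert (Q := sum_n_recursive_bound e _ kappa (proj1 Hk) E0 Es n).
rewrite sum_n_scal in Q.
assert (F := sum_n_le_Series _ (sqterm_nonneg beta f) Hf n). fold (sqnorm beta f) in F.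
assert (Qn := Eb (S n)).
assert (K : 0 <= (1 + / eps) * P1).
{ assert (I := Rinv_0_lt_compat _ He). apply Rmult_le_pos; lra. }
apply (Rmult_le_compat_l _ _ _ K) in F.
apply (Rmult_le_compat_l _ _ _ (proj1 Hk)) in Qn.
apply Rle_trans with (sum_n e n).
- apply sum_n_le. intro k. unfold e. rewrite Rmult_comm.
  apply Rmult_le_compat_r; [apply pow2_ge_0|apply weight'_ge].
- apply (Rmult_le_reg_l (1 - kappa)); [lra|].
  replace ((1 - kappa) * (B / (1 - kappa) * sqnorm beta f)) with (B * sqnorm beta f)
    by (field; lra).
  unfold B. lra.
Qed.

Lemma neumann_S (c : C) (f : nat -> C) : neumann c (S_beta f) = S_beta (neumann c f).
Proof. reflexivity. Qed.

Lemma neumann_left (beta : nat -> R) (c : C) (f : nat -> C) :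
  admissible_weight beta -> Cmod c < 1 -> H2 beta f ->
  neumann c (fun k => f k - c * S_beta f k)%C = f.
Proof.
intros H Hc Hf.
replace (fun k => f k - c * S_beta f k)%C with (fun k => 1 * f k + (- c) * S_beta f k)%C
  by (apply functional_extensionality; intro; ring).
rewrite (neumann_linear beta) by (trivial; now apply H2_S).
apply functional_extensionality. intro k.
rewrite neumann_S, (neumann_rec beta c f k) by trivial.
unfold S_beta, PS_decr_1. ring.
Qed.

(** * The matrix of the composition operator *)

(** If [a] lists the coefficients of a power series [A], this lists those of
    [B = A (z + s) / (1 + s z)], read off from [(1 + s z) B = (z + s) A]. *)
Fixpoint comp_step (s : R) (a : nat -> R) (j : nat) : R :=
  match j with
  | O => s * a 0%nat
  | S i => a i + s * a (S i) - s * comp_step s a i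
  end.

(* [comp_mx s k j] is the coefficient of [z^j] in [((z + s) / (1 + s z))^k]. *)
Fixpoint comp_mx (s : R) (k : nat) : nat -> R :=
  match k with
  | O => fun j => if Nat.eqb j 0 then 1 else 0
  | S i => comp_step s (comp_mx s i)
  end.

Lemma comp_mx_SS (s : R) (k j : nat) :
  comp_mx s (S k) (S j) = comp_mx s k j + s * comp_mx s k (S j) - s * comp_mx s (S k) j.
Proof. reflexivity. Qed.

Lemma comp_mx_S0 (s : R) (k : nat) : comp_mx s (S k) 0 = s * comp_mx s k 0.
Proof. reflexivity. Qed.

Lemma comp_mx_at_0 (k j : nat) : comp_mx 0 k j = if Nat.eqb k j then 1 else 0.
Proof.
revert j. induction k as [|k IH]; intro j; [now destruct j|].
destruct j as [|j]; [rewrite comp_mx_S0; simpl; ring|].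
rewrite comp_mx_SS, IH. simpl Nat.eqb. ring.
Qed.

Lemma is_derive_id_mult (f : R -> R) (s d : R) : is_derive f s d ->
  is_derive (fun s => s * f s) s (f s + s * d).
Proof.
intro H. evar_last; [exact (is_derive_mult (fun s => s) f s _ _ (is_derive_id s) H Rmult_comm)|].
change (1 * f s + s * d = f s + s * d). ring.
Qed.

(* Differentiating [psi_s z = (z + s) / (1 + s z)] in [s] gives
   [(1 - psi_s^2) / (1 - s^2)], hence [k (psi_s^(k-1) - psi_s^(k+1)) / (1 - s^2)]
   for the derivative of [psi_s^k]. *)
Lemma comp_mx_derive (s : R) (k j : nat) : Rabs s < 1 ->
  is_derive (fun s => comp_mx s k j) s
    (INR k * (comp_mx s (pred k) j - comp_mx s (S k) j) / (1 - s ^ 2)).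
Proof.
intro Hs. apply Rabs_lt_between in Hs. assert (N : 1 - s ^ 2 <> 0) by nra.
revert j. induction k as [|k IH]; intro j.
(* The factor [INR 0] cancels the meaningless row [pred 0]. *)
- replace (INR 0 * _ / _) with 0 by (simpl INR; unfold Rdiv; ring).
  apply (is_derive_const (V := R_NormedModule) (if Nat.eqb j 0 then 1 else 0) s).
- induction j as [|j IHj].
  + apply is_derive_ext with (fun s => s * comp_mx s k 0); [reflexivity|].
    evar_last; [exact (is_derive_id_mult _ _ _ (IH 0%nat))|].
    rewrite S_INR, !comp_mx_S0.
    destruct k as [|m]; [simpl INR; simpl Nat.pred; field; exact N|].
    simpl Nat.pred. rewrite !comp_mx_S0. field. exact N.
  + apply is_derive_ext with
      (fun s => comp_mx s k j + s * comp_mx s k (S j) - s * comp_mx s (S k) j); [reflexivity|].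
    evar_last; [exact (is_derive_minus _ _ s _ _
      (is_derive_plus _ _ s _ _ (IH j) (is_derive_id_mult _ _ _ (IH (S j))))
      (is_derive_id_mult _ _ _ IHj))|].
    change plus with Rplus. unfold minus. change plus with Rplus. change opp with Ropp.
    rewrite S_INR. simpl Nat.pred. clear IH IHj.
    destruct k as [|m].
    * rewrite (comp_mx_SS s 1 j), (comp_mx_SS s 0 j). simpl INR. simpl (comp_mx s 0 (S j)).
      field. exact N.
    * simpl Nat.pred.
      (* The recursion is solved for the entry of row [m] and used forwards on the two higher rows;
         what remains is a rational identity in the other entries. *)
      assert (R1 : comp_mx s m j
        = comp_mx s (S m) (S j) - s * comp_mx s m (S j) + s * comp_mx s (S m) j)
        by (rewrite (comp_mx_SS s m j); ring).
      rewrite R1, (comp_mx_SS s (S (S m)) j), (comp_mx_SS s (S m) j).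
      field. exact N.
Qed.

(** This is Cauchy's estimate on the circle of radius [r], where [psi_s] is at most
    [q = (r + a) / (1 - a r)] in modulus. The recursion reproduces it because [r + a + a q r = q]. A
    small [r] gives [q < 1], hence decay in [k]; an [r > 1] gives decay in [j]. *)
Lemma comp_mx_bound (s a r : R) (k j : nat) : Rabs s <= a -> 0 < r -> a * r < 1 ->
  Rabs (comp_mx s k j) <= ((r + a) / (1 - a * r)) ^ k * (/ r) ^ j.
Proof.
intros Hs Hr Ha. assert (S0 := Rabs_pos s).
set (q := (r + a) / (1 - a * r)).
assert (Q : q * (1 - a * r) = r + a) by (unfold q; field; lra).
assert (Q0 : 0 < q) by (apply Rdiv_lt_0_compat; lra). clearbody q.
revert j. induction k as [|k IH]; intro j.
- simpl. assert (P : 0 < (/ r) ^ j) by now apply pow_lt, Rinv_0_lt_compat.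
  destruct j; simpl Nat.eqb; cbv iota; [rewrite Rabs_R1; simpl; lra|rewrite Rabs_R0; lra].
- assert (P : forall i, 0 < q ^ k * (/ r) ^ i).
  { intro i. apply Rmult_lt_0_compat; apply pow_lt; [lra|now apply Rinv_0_lt_compat]. }
  induction j as [|j IHj].
  + rewrite comp_mx_S0, Rabs_mult. specialize (IH 0%nat). specialize (P 0%nat).
    apply Rle_trans with (a * (q ^ k * (/ r) ^ 0)).
    * apply Rmult_le_compat; [lra|apply Rabs_pos|lra|exact IH].
    * replace (q ^ S k * (/ r) ^ 0) with (q * (q ^ k * (/ r) ^ 0)) by (simpl; ring).
      apply Rmult_le_compat_r; [lra|].
      assert (0 <= q * (a * r)) by (repeat apply Rmult_le_pos; lra). lra.
  + rewrite comp_mx_SS. assert (I1 := IH j). assert (I2 := IH (S j)).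
    set (p := q ^ k * (/ r) ^ S j) in *.
    assert (E1 : q ^ k * (/ r) ^ j = r * p) by (unfold p; simpl pow; field; lra).
    assert (E2 : q ^ S k * (/ r) ^ j = q * r * p) by (unfold p; simpl pow; field; lra).
    assert (E3 : q ^ S k * (/ r) ^ S j = q * p) by (unfold p; simpl pow; ring).
    rewrite E1 in I1. rewrite E2 in IHj. rewrite E3.
    assert (P0 : 0 < p) by apply P.
    apply Rle_trans with (1 := Rabs_triang _ _). rewrite Rabs_Ropp.
    apply Rle_trans with (1 := Rplus_le_compat_r _ _ _ (Rabs_triang _ _)).
    rewrite !Rabs_mult.
    assert (J1 : Rabs s * Rabs (comp_mx s k (S j)) <= a * p)
      by (apply Rmult_le_compat; [lra|apply Rabs_pos|lra|exact I2]).
    assert (J2 : Rabs s * Rabs (comp_mx s (S k) j) <= a * (q * r * p))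
      by (apply Rmult_le_compat; [lra|apply Rabs_pos|lra|exact IHj]).
    replace (q * p) with (r * p + a * p + a * (q * r * p)); [lra|].
    replace (r * p + a * p + a * (q * r * p)) with ((r + a + a * q * r) * p) by ring.
    rewrite <- Q. ring.
Qed.

(** * The energy estimate *)

Lemma gronwall (E dE : R -> R) (L delta : R) : 0 <= L -> 0 <= delta ->
  (forall t, 0 <= t <= 1 -> is_derive E t (dE t)) ->
  (forall t, 0 <= t <= 1 -> dE t <= L * E t + delta) ->
  E 1 <= exp L * (E 0 + delta).
Proof.
intros HL Hd HE H.
(* The damped energy [g] is nonincreasing: [exp (- L t) <= 1] lets the linear term absorb
   [delta]. *)
set (g := fun t => exp (- L * t) * E t - delta * t).
set (dg := fun t => exp (- L * t) * (dE t - L * E t) - delta).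
assert (G : forall t, 0 <= t <= 1 -> is_derive g t (dg t)).
{ intros t Ht. unfold g. specialize (HE t Ht).
  evar_last; [auto_derive; [now exists (dE t)|reflexivity]|].
  replace (Derive (fun x : R => E x) t) with (dE t)
    by (symmetry; exact (is_derive_unique _ _ _ HE)).
  unfold dg. ring. }
assert (M : exists c, 0 <= c <= 1 /\ g 1 - g 0 = dg c * (1 - 0)).
{ destruct (MVT_gen g 0 1 dg) as [c Hc].
  - intros t Ht. rewrite Rmin_left, Rmax_right in Ht by lra. apply G. lra.
  - intros t Ht. rewrite Rmin_left, Rmax_right in Ht by lra.
    apply derivable_continuous_pt. exists (dg t). apply is_derive_Reals, G. lra.
  - rewrite Rmin_left, Rmax_right in Hc by lra. now exists c. }
destruct M as [c [Hc M]].
assert (X : exp (- L * c) <= 1).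
{ rewrite <- exp_0. destruct (Rle_lt_or_eq_dec (- L * c) 0) as [A|A]; [nra| |].
  - left. now apply exp_increasing.
  - rewrite A. lra. }
assert (X0 := exp_pos (- L * c)).
assert (Y : dg c <= 0). { unfold dg. specialize (H c Hc). nra. }
assert (Z : g 1 <= g 0) by lra. unfold g in Z.
rewrite Rmult_0_r, exp_0, !Rmult_1_r in Z.
assert (W : exp L * exp (- L) = 1) by (rewrite <- exp_plus, Rplus_opp_r; apply exp_0).
assert (L0 := exp_pos L).
replace (E 1) with (exp L * (exp (- L) * E 1)) by (rewrite <- Rmult_assoc, W; ring).
apply Rmult_le_compat_l; lra.
Qed.

(** The difference splits as [beta_(k+1)^2 + k (beta_(k+1) - beta_k) (beta_(k+1) + beta_k)], and
    polynomial growth bounds [k |beta_(k+1) - beta_k|] by [M beta_k]. Comparability of neighbouring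
    weights then turns every product into a multiple of [beta_k beta_(k+1)]. *)
Lemma growth_defect (beta : nat -> R) : admissible_weight beta -> polynomial_growth beta ->
  exists C, 0 <= C /\ forall k,
    Rabs (INR (S k) * beta (S k) ^ 2 - INR k * beta k ^ 2) <= C * (beta k * beta (S k)).
Proof.
intros H [M HM]. assert (Hp := proj1 H).
destruct (weight'_le beta 2 H ltac:(lra)) as [P [P0 HP]].
assert (M0 : 0 <= M).
{ apply Rle_trans with (2 := HM 1%nat ltac:(lia)).
  apply Rmult_le_pos; [simpl; lra|apply Rabs_pos]. }
set (m := 1 + 2 * P).
exists (1 + 2 * M + M * m). split; [unfold m; nra|]. intro k.
assert (B := Hp k). assert (B' := Hp (S k)).
assert (Q := HM (S k) ltac:(lia)). unfold weight_ratio in Q. simpl Nat.pred in Q.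
assert (Q1 : (INR k + 2) * Rabs (beta (S k) - beta k) <= M * beta k).
{ replace (beta (S k) - beta k) with ((beta (S k) / beta k - 1) * beta k) by (field; lra).
  rewrite Rabs_mult, (Rabs_pos_eq (beta k)), <- Rmult_assoc by lra.
  apply Rmult_le_compat_r; [lra|]. rewrite S_INR in Q. lra. }
(* The equivalent weight gives [beta_k^2 <= 2 P beta_(k+1)^2], and [2 P <= m ^ 2]. *)
assert (Q2 : beta k <= m * beta (S k)).
{ assert (W := weight'_step beta 2 k Hp ltac:(lra)). assert (W1 := weight'_ge beta 2 k).
  assert (W2 := HP (S k)). unfold m.
  apply Rsqr_incr_0_var; [|nra]. rewrite !Rsqr_pow2, Rpow_mult_distr.
  assert (B2 := pow_lt _ 2 B').
  apply Rle_trans with ((2 * P) * beta (S k) ^ 2); [lra|].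
  apply Rmult_le_compat_r; nra. }
assert (K := pos_INR k).
assert (D := Rabs_pos (beta (S k) - beta k)).
assert (Q3 : beta (S k) - beta k <= M * beta k)
  by (assert (T := Rle_abs (beta (S k) - beta k)); nra).
rewrite S_INR.
replace ((INR k + 1) * beta (S k) ^ 2 - INR k * beta k ^ 2) with
  (beta (S k) * beta (S k) + INR k * ((beta (S k) - beta k) * (beta (S k) + beta k))) by ring.
apply Rle_trans with (1 := Rabs_triang _ _).
rewrite (Rabs_pos_eq (beta (S k) * beta (S k))) by nra.
rewrite !Rabs_mult, (Rabs_pos_eq (INR k)), (Rabs_pos_eq (beta (S k) + beta k)) by lra.
assert (Q4 : INR k * Rabs (beta (S k) - beta k) <= M * beta k) by nra.
assert (Q5 : beta (S k) * beta (S k) <= (1 + M) * beta k * beta (S k)) by nra.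
assert (Q6 : INR k * Rabs (beta (S k) - beta k) * (beta (S k) + beta k)
  <= M * beta k * (beta (S k) + beta k)) by nra.
assert (Q7 : M * beta k * beta k <= M * beta k * (m * beta (S k)))
  by (apply Rmult_le_compat_l; nra).
lra.
Qed.

(* Summation by parts turns the energy derivative into these products. *)
Lemma energy_defect (beta : nat -> R) (C : R) (F : nat -> R) (n : nat) :
  (forall k, Rabs (INR (S k) * beta (S k) ^ 2 - INR k * beta k ^ 2) <= C * (beta k * beta (S k))) ->
  0 <= C -> (forall k, 0 < beta k) ->
  Rabs (sum_n (fun k => beta k ^ 2 * (INR k * F k * (F (pred k) - F (S k)))) n
    + INR n * beta n ^ 2 * F n * F (S n))
  <= C * sum_n (fun k => beta k ^ 2 * F k ^ 2) n.
Proof.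
intros H C0 Hp.
(* Each [beta_k^2 F_k^2] is shared by the products with the indices [k - 1] and [k + 1]. The half
   still unspent at [n] is kept in the induction hypothesis to pay for the next product. *)
assert (A : Rabs (sum_n (fun k => beta k ^ 2 * (INR k * F k * (F (pred k) - F (S k)))) n
    + INR n * beta n ^ 2 * F n * F (S n))
  <= C * (sum_n (fun k => beta k ^ 2 * F k ^ 2) n - beta n ^ 2 * F n ^ 2 / 2)).
{ induction n as [|n IH].
  - rewrite !sum_n_zero. simpl INR.
    replace (beta 0%nat ^ 2 * (0 * F 0%nat * (F (pred 0) - F 1%nat))
      + 0 * beta 0%nat ^ 2 * F 0%nat * F 1%nat) with 0 by ring.
    rewrite Rabs_R0. assert (T := pow2_ge_0 (beta 0%nat * F 0%nat)). nra.
  - rewrite !sum_n_S. set (s1 := sum_n _ n) in *. set (s2 := sum_n _ n) in *.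
    simpl Nat.pred.
    replace (s1 + beta (S n) ^ 2 * (INR (S n) * F (S n) * (F n - F (S (S n))))
      + INR (S n) * beta (S n) ^ 2 * F (S n) * F (S (S n)))
      with (s1 + INR n * beta n ^ 2 * F n * F (S n)
        + (INR (S n) * beta (S n) ^ 2 - INR n * beta n ^ 2) * (F n * F (S n))) by ring.
    apply Rle_trans with (1 := Rabs_triang _ _). rewrite (Rabs_mult (_ - _)).
    assert (T := Rmult_le_compat_r _ _ _ (Rabs_pos (F n * F (S n))) (H n)).
    assert (Y : beta n * beta (S n) * Rabs (F n * F (S n))
      <= beta n ^ 2 * F n ^ 2 / 2 + beta (S n) ^ 2 * F (S n) ^ 2 / 2).
    { rewrite Rabs_mult, <- (pow2_abs (F n)), <- (pow2_abs (F (S n))).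
      assert (Z := pow2_ge_0 (beta n * Rabs (F n) - beta (S n) * Rabs (F (S n)))). nra. }
    apply (Rmult_le_compat_l _ _ _ C0) in Y. lra. }
assert (T := pow2_ge_0 (beta n * F n)). nra.
Qed.

Lemma sum_n_eq (a b : nat -> R) (n : nat) : (forall k, a k = b k) -> sum_n a n = sum_n b n :> R.
Proof. intro H. now apply sum_n_ext. Qed.

(** This is [X_s] applied to [f] cut off after index [n]; the finite sum can be differentiated
    termwise in [s]. *)
Definition comp_fin (s : R) (n : nat) (f : nat -> R) (k : nat) : R :=
  sum_n (fun j => comp_mx s k j * f j) n.

Lemma comp_fin_derive (s t : R) (n : nat) (f : nat -> R) (k : nat) : Rabs (s * t) < 1 ->
  is_derive (fun t => comp_fin (s * t) n f k) t
    (s / (1 - (s * t) ^ 2)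
      * (INR k * (comp_fin (s * t) n f (pred k) - comp_fin (s * t) n f (S k)))).
Proof.
intro H. evar_last.
- apply (is_derive_sum_n (K := R_AbsRing) (V := R_NormedModule)
    (fun j t => comp_mx (s * t) k j * f j)). intros j _.
  apply is_derive_ext with (fun t => f j * comp_mx (s * t) k j); [intro; apply Rmult_comm|].
  apply is_derive_scal.
  apply (is_derive_comp (fun s => comp_mx s k j) (fun t => s * t)).
  + now apply comp_mx_derive.
  + apply (is_derive_scal (fun t => t) t s 1). apply (is_derive_id (K := R_AbsRing)).
- change (@eq R (sum_n (fun j => f j * (s * 1 *
      (INR k * (comp_mx (s * t) (pred k) j - comp_mx (s * t) (S k) j) / (1 - (s * t) ^ 2)))) n)
    (s / (1 - (s * t) ^ 2)
      * (INR k * (comp_fin (s * t) n f (pred k) - comp_fin (s * t) n f (S k))))).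
  unfold comp_fin. induction n as [|n IH].
  + rewrite !sum_n_zero. unfold Rdiv. ring.
  + rewrite !sum_n_S, IH. unfold Rdiv. ring.
Qed.

Lemma comp_fin_at_0 (n : nat) (f : nat -> R) (k : nat) :
  comp_fin 0 n f k = if Nat.leb k n then f k else 0.
Proof.
unfold comp_fin. induction n as [|n IH].
- rewrite sum_n_zero, comp_mx_at_0. destruct k; simpl; ring.
- rewrite sum_n_S, IH, comp_mx_at_0.
  destruct (Nat.leb_spec k n), (Nat.eqb_spec k (S n)), (Nat.leb_spec k (S n)); try lia;
    subst; ring.
Qed.

Lemma sum_n_cut (g : nat -> R) (n K : nat) : (forall k, 0 <= g k) ->
  sum_n (fun k => if Nat.leb k n then g k else 0) K <= sum_n g n.
Proof.
intro H.
assert (A : sum_n (fun k => if Nat.leb k n then g k else 0) K = sum_n g (Nat.min K n) :> R).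
{ induction K as [|K IH]; [now rewrite !sum_n_zero|].
  rewrite sum_n_S, IH. destruct (Nat.leb_spec (S K) n).
  - rewrite !Nat.min_l by lia. now rewrite sum_n_S.
  - rewrite !Nat.min_r by lia. ring. }
rewrite A. clear A. assert (L := Nat.le_min_r K n). revert L. generalize (Nat.min K n). intros m L.
induction L as [|n' L IH]; [apply Rle_refl|].
apply Rle_trans with (1 := IH). now apply sum_n_incr.
Qed.

Lemma comp_fin_bound (s a r : R) (n : nat) (f : nat -> R) (k : nat) :
  Rabs s <= a -> 0 < r -> a * r < 1 ->
  Rabs (comp_fin s n f k)
    <= ((r + a) / (1 - a * r)) ^ k * sum_n (fun j => (/ r) ^ j * Rabs (f j)) n.
Proof.
intros Hs Hr Ha. unfold comp_fin. rewrite <- sum_n_scal.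
assert (T : forall j, Rabs (comp_mx s k j * f j)
  <= ((r + a) / (1 - a * r)) ^ k * ((/ r) ^ j * Rabs (f j))).
{ intro j. rewrite Rabs_mult, <- Rmult_assoc.
  apply Rmult_le_compat_r; [apply Rabs_pos|now apply comp_mx_bound]. }
induction n as [|n IH]; [rewrite !sum_n_zero; apply T|].
rewrite !sum_n_S. apply Rle_trans with (1 := Rabs_triang _ _).
specialize (T (S n)). lra.
Qed.

(** Gronwall's lemma is applied along [s t], [0 <= t <= 1], from the identity matrix at [t = 0]. The
    constant depends on neither the cut [n] of the data nor the cut [K] of the image, as both limits
    are taken later. *)
Lemma comp_energy (beta : nat -> R) (s : R) : admissible_weight beta ->
  polynomial_growth beta -> Rabs s < 1 ->
  exists C, forall f n K,
    sum_n (fun k => beta k ^ 2 * comp_fin s n f k ^ 2) K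
      <= C * sum_n (fun k => beta k ^ 2 * f k ^ 2) n.
Proof.
intros H Hg Hs. assert (Hp := proj1 H).
destruct (growth_defect beta H Hg) as [C [C0 HC]].
set (a := Rabs s) in *. assert (A0 : 0 <= a) by apply Rabs_pos.
set (L := 2 * C / (1 - a ^ 2)).
assert (D : 0 < 1 - a ^ 2) by nra.
assert (L0 : 0 <= L) by (apply Rdiv_le_0_compat; lra).
exists (exp L). intros f n K.
(* With this radius [r (1 + a) < 1 - a], which is the condition for [q < 1]. *)
set (r := (1 - a) / (2 * (1 + a))).
assert (Er : r * (2 * (1 + a)) = 1 - a) by (unfold r; field; lra).
assert (R0 : 0 < r) by (apply Rdiv_lt_0_compat; lra).
assert (Ra : a * r < 1) by nra.
set (q := (r + a) / (1 - a * r)).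
assert (Eq : q * (1 - a * r) = r + a) by (unfold q; field; lra).
assert (Q0 : 0 < q) by (apply Rdiv_lt_0_compat; lra).
assert (Q1 : q < 1) by (apply Rlt_div_l; [lra|nra]).
set (A := sum_n (fun j => (/ r) ^ j * Rabs (f j)) n).
assert (AP : 0 <= A).
{ apply sum_n_nonneg. intro j. apply Rmult_le_pos; [|apply Rabs_pos].
  apply pow_le, Rlt_le, Rinv_0_lt_compat, R0. }
set (F := fun t k => comp_fin (s * t) n f k).
assert (St : forall t, 0 <= t <= 1 -> Rabs (s * t) <= a).
{ intros t Ht. rewrite Rabs_mult, (Rabs_pos_eq t) by lra. fold a. nra. }
assert (HF : forall t k, 0 <= t <= 1 -> Rabs (F t k) <= q ^ k * A).
{ intros t k Ht. unfold F, q, A. apply comp_fin_bound; auto. }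
set (E := fun N t => sum_n (fun k => beta k ^ 2 * F t k ^ 2) N).
set (S0 := sum_n (fun k => beta k ^ 2 * f k ^ 2) n).
assert (E0 : forall N, E N 0 <= S0).
{ intro N. unfold E, S0.
  rewrite (sum_n_eq _ (fun k => if Nat.leb k n then beta k ^ 2 * f k ^ 2 else 0)).
  - apply sum_n_cut. intro k. apply Rmult_le_pos; apply pow2_ge_0.
  - intro k. unfold F. rewrite Rmult_0_r, comp_fin_at_0. destruct (Nat.leb k n); ring. }
(* A bound for the boundary term at [N], uniform in [t]: [F_N] and [F_(N+1)] are both at most
   [q^N A]. *)
set (delta := fun N => 2 / (1 - a ^ 2) * ((INR N + 1) * beta N ^ 2 * (q ^ 2) ^ N) * A ^ 2).
assert (step : forall N, E N 1 <= exp L * (E N 0 + delta N)).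
{ intro N. assert (NP := pos_INR N). assert (BP := pow_lt _ 2 (Hp N)).
  assert (dP : 0 <= delta N).
  { unfold delta. apply Rmult_le_pos; [|apply pow2_ge_0].
    apply Rmult_le_pos; [apply Rdiv_le_0_compat; lra|].
    apply Rmult_le_pos; [apply Rmult_le_pos; lra|]. apply pow_le, pow2_ge_0. }
  apply (gronwall (E N) (fun t => 2 * s / (1 - (s * t) ^ 2)
    * sum_n (fun k => beta k ^ 2 * (INR k * F t k * (F t (pred k) - F t (S k)))) N)); trivial.
  - intros t Ht. unfold E. assert (Z := St t Ht).
    evar_last.
    + apply (is_derive_sum_n (K := R_AbsRing) (V := R_NormedModule)
        (fun k t => beta k ^ 2 * F t k ^ 2)). intros k _.
      apply is_derive_scal. apply (is_derive_pow (fun t => F t k) 2).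
      unfold F. apply comp_fin_derive. lra.
    + rewrite <- sum_n_scal. apply sum_n_eq. intro k. unfold F. simpl pow. simpl INR.
      unfold Rdiv. ring.
  - intros t Ht. assert (Z := St t Ht). assert (Z0 := Rabs_pos (s * t)).
    assert (Z2 : (s * t) ^ 2 <= a ^ 2).
    { rewrite <- (pow2_abs (s * t)). apply pow_incr. lra. }
    assert (G := energy_defect beta C (F t) N HC C0 Hp). fold (E N t) in G.
    set (sm := sum_n _ N) in *.
    assert (X : Rabs sm <= C * E N t + (INR N + 1) * beta N ^ 2 * (q ^ 2) ^ N * A ^ 2).
    { replace sm with ((sm + INR N * beta N ^ 2 * F t N * F t (S N))
        - INR N * beta N ^ 2 * F t N * F t (S N)) by ring.
      apply Rle_trans with (1 := Rabs_triang _ _). rewrite Rabs_Ropp.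
      apply Rplus_le_compat; [exact G|].
      rewrite !Rabs_mult, (Rabs_pos_eq (INR N)), (Rabs_pos_eq (beta N ^ 2)) by lra.
      assert (F1 := HF t N Ht). assert (F2 := HF t (S N) Ht).
      assert (qN := pow_lt _ N Q0).
      assert (F3 : Rabs (F t (S N)) <= q ^ N * A).
      { apply Rle_trans with (1 := F2). simpl pow. apply Rmult_le_compat_r; [exact AP|nra]. }
      rewrite !Rmult_assoc.
      assert (P12 : Rabs (F t N) * Rabs (F t (S N)) <= (q ^ 2) ^ N * A ^ 2).
      { replace ((q ^ 2) ^ N * A ^ 2) with ((q ^ N * A) * (q ^ N * A))
          by (rewrite <- pow_mult, Nat.mul_comm, pow_mult; ring).
        apply Rmult_le_compat; try apply Rabs_pos; assumption. }
      assert (PP : 0 <= Rabs (F t N) * Rabs (F t (S N)))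
        by (apply Rmult_le_pos; apply Rabs_pos).
      apply Rmult_le_compat; [lra| |lra|].
      - apply Rmult_le_pos; lra.
      - apply Rmult_le_compat_l; lra. }
    apply Rle_trans with (1 := Rle_abs _).
    rewrite Rabs_mult. unfold Rdiv at 1. rewrite Rabs_mult, Rabs_mult, (Rabs_pos_eq 2) by lra.
    fold a. rewrite (Rabs_pos_eq (/ _)) by (apply Rlt_le, Rinv_0_lt_compat; lra).
    assert (I : / (1 - (s * t) ^ 2) <= / (1 - a ^ 2)) by (apply Rinv_le_contravar; lra).
    assert (I0 : 0 < / (1 - (s * t) ^ 2)) by (apply Rinv_0_lt_compat; lra).
    replace (L * E N t + delta N) with (2 * 1 * / (1 - a ^ 2) *
      (C * E N t + (INR N + 1) * beta N ^ 2 * (q ^ 2) ^ N * A ^ 2))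
      by (unfold L, delta; field; lra).
    apply Rmult_le_compat; [|apply Rabs_pos| |exact X].
    + apply Rmult_le_pos; lra.
    + apply Rmult_le_compat; lra. }
assert (dl : is_lim_seq delta 0).
{ unfold delta. replace (Finite 0) with (Finite (2 / (1 - a ^ 2) * 0 * A ^ 2)) by (f_equal; ring).
  apply is_lim_seq_mult'; [|apply is_lim_seq_const].
  apply is_lim_seq_mult'; [apply is_lim_seq_const|].
  apply ex_series_lim_0, growth_summable; [exact H|]. nra. }
assert (lim : is_lim_seq (fun N => exp L * (S0 + delta N)) (exp L * (S0 + 0))).
{ apply is_lim_seq_mult'; [apply is_lim_seq_const|].
  apply is_lim_seq_plus'; [apply is_lim_seq_const|exact dl]. }
rewrite Rplus_0_r in lim.
(* For fixed [K] the sum up to [K] is below every later truncated energy, so [N] can go to infinity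
   and [delta] disappears. *)
assert (Fin : Rbar_le (E K 1) (exp L * S0)).
{ apply is_lim_seq_le_loc with (fun _ => E K 1) (fun N => exp L * (S0 + delta N));
    [|apply is_lim_seq_const|exact lim].
  exists K. intros N HN. apply Rle_trans with (E N 1).
  - unfold E. induction HN as [|m HN IH]; [apply Rle_refl|]. apply Rle_trans with (1 := IH).
    apply sum_n_incr. intro k. apply Rmult_le_pos; apply pow2_ge_0.
  - apply Rle_trans with (1 := step N). apply Rmult_le_compat_l; [left; apply exp_pos|].
    specialize (E0 N). lra. }
simpl in Fin. unfold E, F in Fin. rewrite Rmult_1_r in Fin. exact Fin.
Qed.

(** * The composition matrix on the whole space *)

Definition comp_op (s : R) : operator :=
  fun f k => CSeries (fun j => comp_mx s k j * f j)%C.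

Lemma comp_summable (beta : nat -> R) (s : R) (f : nat -> C) (k : nat) :
  admissible_weight beta -> Rabs s < 1 -> H2 beta f ->
  csummable (fun j => comp_mx s k j * f j)%C.
Proof.
intros H Hs Hf. assert (Hp := proj1 H).
set (a := Rabs s) in *. assert (A0 : 0 <= a) by apply Rabs_pos.
(* A radius beyond the unit circle but inside the pole at distance [/ a], so that the row decays
   geometrically in [j] and beats the dual weight [/ beta j]. *)
set (r := 2 / (1 + a)).
assert (Er : r * (1 + a) = 2) by (unfold r; field; lra).
assert (R1 : 1 < r) by nra.
assert (Ra : a * r < 1) by nra.
set (q := (r + a) / (1 - a * r)).
assert (R2 : 0 < / r < 1).
{ split; [apply Rinv_0_lt_compat; lra|]. rewrite <- Rinv_1. apply Rinv_lt_contravar; lra. }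
set (v := fun j => (q ^ k) ^ 2 * ((/ beta j) ^ 2 * ((/ r) ^ 2) ^ j)).
assert (V : ex_series v).
{ apply (ex_series_scal_l (V := R_NormedModule)).
  apply (weight_summable _ _ (admissible_inv _ H)). nra. }
apply csummable_le with (fun j => v j + Cmod (f j) ^ 2 * beta j ^ 2);
  [|exact (ex_series_plus _ _ V Hf)].
intro j. assert (B := Hp j).
assert (T := comp_mx_bound s a r k j (Rle_refl _) ltac:(lra) Ra). fold q in T.
rewrite Cmod_mult, Cmod_R.
assert (T2 : Rabs (comp_mx s k j) ^ 2 <= (q ^ k * (/ r) ^ j) ^ 2)
  by (apply pow_incr; split; [apply Rabs_pos|exact T]).
set (y := Rabs (comp_mx s k j)) in *. set (x := Cmod (f j)).
assert (v j = (q ^ k * (/ r) ^ j) ^ 2 * (/ beta j) ^ 2) as ->.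
{ unfold v. rewrite <- (pow_mult (/ r)), (Nat.mul_comm 2 j), pow_mult. ring. }
assert (I2 := pow2_ge_0 (/ beta j)).
apply Rle_trans with (y ^ 2 * (/ beta j) ^ 2 + x ^ 2 * beta j ^ 2);
  [|apply Rplus_le_compat_r, Rmult_le_compat_r; assumption].
assert (Z := pow2_ge_0 (y * / beta j - x * beta j)).
assert (W := pow2_ge_0 (y * / beta j + x * beta j)).
assert (y * / beta j * (x * beta j) = y * x) by (field; lra).
nra.
Qed.

Lemma comp_op_linear (beta : nat -> R) (s : R) : admissible_weight beta -> Rabs s < 1 ->
  linear_on beta (comp_op s).
Proof.
intros H Hs a b f g Hf Hg. apply functional_extensionality. intro k. unfold comp_op.
rewrite <- CSeries_lin by now apply (comp_summable beta).
apply CSeries_ext. intro n. ring.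
Qed.

Lemma is_lim_seq_sum_n (u : nat -> nat -> R) (l : nat -> R) (K : nat) :
  (forall k, is_lim_seq (u k) (l k)) ->
  is_lim_seq (fun n => sum_n (fun k => u k n) K) (sum_n l K).
Proof.
intro H. induction K as [|K IH].
- rewrite sum_n_zero. apply is_lim_seq_ext with (u 0%nat); [|apply H].
  intro n. now rewrite sum_n_zero.
- rewrite sum_n_S.
  apply is_lim_seq_ext with (fun n => sum_n (fun k => u k n) K + u (S K) n).
  + intro n. now rewrite sum_n_S.
  + apply is_lim_seq_plus'; [exact IH|apply H].
Qed.

Lemma sum_n_add (a b : nat -> R) (n : nat) :
  sum_n (fun k => a k + b k) n = sum_n a n + sum_n b n :> R.
Proof. exact (sum_n_plus a b n). Qed.

(** The matrix is real, so the real energy estimate applies to [Re f] and [Im f] separately. The cut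
    of the data is removed first, inside a fixed partial sum of the image. *)
Lemma comp_op_bounded (beta : nat -> R) (s : R) : admissible_weight beta ->
  polynomial_growth beta -> Rabs s < 1 -> bounded_operator beta (comp_op s).
Proof.
intros H Hg Hs. assert (Hp := proj1 H).
destruct (comp_energy beta s H Hg Hs) as [C0 HC0].
set (C := Rmax 0 C0). assert (CP : 0 <= C) by apply Rmax_l.
assert (HC : forall f n K, sum_n (fun k => beta k ^ 2 * comp_fin s n f k ^ 2) K
  <= C * sum_n (fun k => beta k ^ 2 * f k ^ 2) n).
{ intros f n K. apply Rle_trans with (1 := HC0 f n K).
  apply Rmult_le_compat_r; [|apply Rmax_r]. apply sum_n_nonneg. intro k.
  apply Rmult_le_pos; apply pow2_ge_0. }
apply (bounded_operator_partial_sums beta _ C); [now apply comp_op_linear|].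
intros f K Hf.
set (u := fun j => Re (f j)). set (v := fun j => Im (f j)).
assert (Su : forall k, is_lim_seq (fun n => comp_fin s n u k) (Re (comp_op s f k))).
{ intro k. apply is_lim_seq_ext with (sum_n (fun j => Re (comp_mx s k j * f j)%C)).
  - intro n. apply sum_n_eq. intro j. unfold u. destruct (f j). unfold Re. simpl. ring.
  - exact (Series_correct _ (csummable_Re _ (comp_summable beta s f k H Hs Hf))). }
assert (Sv : forall k, is_lim_seq (fun n => comp_fin s n v k) (Im (comp_op s f k))).
{ intro k. apply is_lim_seq_ext with (sum_n (fun j => Im (comp_mx s k j * f j)%C)).
  - intro n. apply sum_n_eq. intro j. unfold v. destruct (f j). unfold Im. simpl. ring.
  - exact (Series_correct _ (csummable_Im _ (comp_summable beta s f k H Hs Hf))). }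
assert (L : is_lim_seq
  (fun n => sum_n (fun k => beta k ^ 2 * (comp_fin s n u k ^ 2 + comp_fin s n v k ^ 2)) K)
  (sum_n (fun k => Cmod (comp_op s f k) ^ 2 * beta k ^ 2) K)).
{ rewrite (sum_n_eq _ (fun k => beta k ^ 2
    * (Re (comp_op s f k) * Re (comp_op s f k) + Im (comp_op s f k) * Im (comp_op s f k)))).
  - apply (is_lim_seq_sum_n
      (fun k n => beta k ^ 2 * (comp_fin s n u k ^ 2 + comp_fin s n v k ^ 2))).
    intro k. apply is_lim_seq_mult'; [apply is_lim_seq_const|].
    apply is_lim_seq_plus'.
    + apply is_lim_seq_ext with (fun n => comp_fin s n u k * comp_fin s n u k);
        [intro; ring|]. apply is_lim_seq_mult'; apply Su.
    + apply is_lim_seq_ext with (fun n => comp_fin s n v k * comp_fin s n v k);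
        [intro; ring|]. apply is_lim_seq_mult'; apply Sv.
  - intro k. rewrite Cmod2_alt. ring. }
assert (B : forall n,
  sum_n (fun k => beta k ^ 2 * (comp_fin s n u k ^ 2 + comp_fin s n v k ^ 2)) K
  <= C * sqnorm beta f).
{ intro n.
  rewrite (sum_n_eq _ (fun k => beta k ^ 2 * comp_fin s n u k ^ 2
    + beta k ^ 2 * comp_fin s n v k ^ 2)) by (intro; ring).
  rewrite sum_n_add.
  apply Rle_trans with (C * (sum_n (fun k => beta k ^ 2 * u k ^ 2) n
    + sum_n (fun k => beta k ^ 2 * v k ^ 2) n)).
  - rewrite Rmult_plus_distr_l. apply Rplus_le_compat; apply HC.
  - apply Rmult_le_compat_l; [exact CP|]. rewrite <- sum_n_add.
    rewrite (sum_n_eq _ (fun k => Cmod (f k) ^ 2 * beta k ^ 2)).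
    + apply (sum_n_le_Series _ (sqterm_nonneg beta f) Hf).
    + intro k. rewrite Cmod2_alt. unfold u, v. ring. }
exact (is_lim_seq_le _ _ _ _ B L (is_lim_seq_const _)).
Qed.

Lemma Series_zero : Series (fun _ => 0) = 0.
Proof.
rewrite (Series_ext _ (fun _ => 0 * 0)) by (intro; ring). rewrite Series_scal_l. ring.
Qed.

Lemma comp_op_0 (s : R) (f : nat -> C) : comp_op s f 0%nat = f 0%nat.
Proof.
unfold comp_op.
rewrite (CSeries_ext _ (fun j => if Nat.eqb j 0 then f 0%nat else 0%C)).
- assert (Z : csummable (fun j => if Nat.eqb j 0 then f 0%nat else 0%C)).
  { apply csummable_le with (fun j => Cmod (f 0%nat) * (1 / 2) ^ j).
    - intro j. assert (P := pow_le (1 / 2) j ltac:(lra)). assert (P' := Cmod_ge_0 (f 0%nat)).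
      destruct j; simpl Nat.eqb; cbv iota; [simpl; lra|]. rewrite Cmod_0. nra.
    - apply (ex_series_scal_l (V := R_NormedModule)). apply ex_series_geom.
      rewrite Rabs_pos_eq; lra. }
  rewrite (CSeries_incr_1 _ Z). simpl. unfold CSeries. simpl.
  rewrite Series_zero. apply injective_projections; simpl; ring.
- intro j. simpl comp_mx. destruct j; simpl; ring.
Qed.

(** Under the bilinear pairing of coefficients [S_beta] is the transpose of multiplication by [z].
    Both sides therefore pair [u] with the same series, [(1 + s z) psi^(k+1) = (z + s) psi^k]. *)
Lemma comp_op_intertwine (beta : nat -> R) (s : R) (u : nat -> C) :
  admissible_weight beta -> Rabs s < 1 -> H2 beta u ->
  forall k, comp_op s (fun i => u i + s * S_beta u i)%C (S k)
    = comp_op s (fun i => S_beta u i + s * u i)%C k.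
Proof.
intros H Hs Hu k. assert (Hv := H2_S beta u H Hu).
set (y := comp_mx s).
assert (Y1 : csummable (fun j => y (S k) j * u j)%C) by now apply (comp_summable beta).
assert (Y0 : csummable (fun j => y k j * u j)%C) by now apply (comp_summable beta).
assert (Z1 : csummable (fun j => y (S k) j * S_beta u j)%C) by now apply (comp_summable beta).
assert (Z0 : csummable (fun j => y k j * S_beta u j)%C) by now apply (comp_summable beta).
unfold comp_op. fold y.
transitivity (1 * CSeries (fun j => y (S k) j * u j) + s * CSeries (fun j => y (S k) j * S_beta u j))%C.
{ rewrite <- CSeries_lin by assumption. apply CSeries_ext. intro j. ring. }
transitivity (1 * CSeries (fun j => y k j * S_beta u j) + s * CSeries (fun j => y k j * u j))%C.
2: { rewrite <- CSeries_lin by assumption. apply CSeries_ext. intro j. ring. }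
rewrite (CSeries_incr_1 _ Y1), (CSeries_incr_1 _ Y0).
assert (Y1' := csummable_S _ Y1). assert (Y0' := csummable_S _ Y0).
assert (X : CSeries (fun j => 1 * (y (S k) (S j) * u (S j)) + s * (y (S k) j * S_beta u j))%C
  = CSeries (fun j => 1 * (y k j * S_beta u j) + s * (y k (S j) * u (S j)))%C).
{ apply CSeries_ext. intro j. unfold S_beta, PS_decr_1, y. rewrite comp_mx_SS.
  rewrite RtoC_minus, RtoC_plus, !RtoC_mult. ring. }
rewrite !CSeries_lin in X by assumption.
unfold y at 1. rewrite comp_mx_S0, RtoC_mult. fold y.
transitivity (s * y k 0%nat * u 0%nat + (1 * CSeries (fun n => y (S k) (S n) * u (S n)) +
     s * CSeries (fun n => y (S k) n * S_beta u n)))%C; [ring|].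
rewrite X. ring.
Qed.

(** * Circle integrals *)

Lemma inner_CSeries (beta : nat -> R) (f g : nat -> C) :
  inner beta f g = CSeries (fun k => RtoC (beta k ^ 2) * (f k * Cconj (g k)))%C.
Proof.
unfold inner, CSeries. f_equal; apply Series_ext; intro k;
  destruct (f k * Cconj (g k))%C; unfold Re, Im; simpl; ring.
Qed.

Lemma inner_term_bound (beta : nat -> R) (tau : R) (f g : nat -> C) (k : nat) : 0 < tau ->
  Cmod (RtoC (beta k ^ 2) * (f k * Cconj (g k)))
    <= / tau / 2 * (Cmod (f k) ^ 2 * beta k ^ 2) + tau / 2 * (Cmod (g k) ^ 2 * beta k ^ 2).
Proof.
intro Ht. rewrite !Cmod_mult, Cmod_R, Cmod_conj, Rabs_pos_eq by apply pow2_ge_0.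
set (x := Cmod (f k)). set (y := Cmod (g k)).
assert (P := pow2_ge_0 (beta k)). assert (Q := pow2_ge_0 (x - tau * y)).
assert (I := Rinv_0_lt_compat _ Ht).
assert (Z := Rmult_le_pos _ _ (Rmult_le_pos _ _ (Rlt_le _ _ I) P) Q).
replace (/ tau * beta k ^ 2 * (x - tau * y) ^ 2) with
  (/ tau * (x ^ 2 * beta k ^ 2) + tau * (y ^ 2 * beta k ^ 2) - 2 * (beta k ^ 2 * (x * y)))
  in Z by (field; lra).
lra.
Qed.

Lemma inner_summable (beta : nat -> R) (f g : nat -> C) : H2 beta f -> H2 beta g ->
  csummable (fun k => RtoC (beta k ^ 2) * (f k * Cconj (g k)))%C.
Proof.
intros Hf Hg. apply csummable_le with (1 := fun k => inner_term_bound beta 1 f g k Rlt_0_1).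
apply (ex_series_plus (V := R_NormedModule)
  (fun k => / 1 / 2 * (Cmod (f k) ^ 2 * beta k ^ 2))
  (fun k => 1 / 2 * (Cmod (g k) ^ 2 * beta k ^ 2)));
  now apply (ex_series_scal_l (V := R_NormedModule)).
Qed.

(** A Cauchy-Schwarz inequality in arithmetic-geometric form. The free parameter [tau] allows a
    small first vector to be balanced against a fixed second one. *)
Lemma inner_bound (beta : nat -> R) (tau : R) (f g : nat -> C) : 0 < tau ->
  H2 beta f -> H2 beta g ->
  Cmod (inner beta f g) <= / tau * sqnorm beta f + tau * sqnorm beta g.
Proof.
intros Ht Hf Hg. rewrite inner_CSeries.
assert (A : ex_series (fun k => / tau / 2 * (Cmod (f k) ^ 2 * beta k ^ 2)))
  by now apply (ex_series_scal_l (V := R_NormedModule)).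
assert (B : ex_series (fun k => tau / 2 * (Cmod (g k) ^ 2 * beta k ^ 2)))
  by now apply (ex_series_scal_l (V := R_NormedModule)).
apply Rle_trans with (1 := CSeries_bound _ _ (fun k => inner_term_bound beta tau f g k Ht)
  (ex_series_plus _ _ A B)).
rewrite Series_plus, !Series_scal_l by assumption. unfold sqnorm. right. field. lra.
Qed.

Lemma inner_lin (beta : nat -> R) (a b : C) (f g h : nat -> C) :
  H2 beta f -> H2 beta g -> H2 beta h ->
  inner beta (fun k => a * f k + b * g k)%C h = (a * inner beta f h + b * inner beta g h)%C.
Proof.
intros Hf Hg Hh. rewrite !inner_CSeries, <- CSeries_lin by now apply inner_summable.
apply CSeries_ext. intro k. ring.
Qed.

Lemma inner_scal (beta : nat -> R) (a : C) (f h : nat -> C) :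
  H2 beta f -> H2 beta h -> inner beta (fun k => a * f k)%C h = (a * inner beta f h)%C.
Proof.
intros Hf Hh. transitivity (a * inner beta f h + 0 * inner beta f h)%C; [|ring].
rewrite <- inner_lin by assumption. f_equal. apply functional_extensionality. intro. ring.
Qed.

Definition circle (r t : R) : C := (r * cos t, r * sin t).

Lemma Cmod_circle (r t : R) : 0 <= r -> Cmod (circle r t) = r.
Proof.
intro Hr. replace (circle r t) with (RtoC r * (cos t, sin t))%C
  by (apply injective_projections; simpl; ring).
rewrite Cmod_mult, Cmod_R, Cmod_cis, Rabs_pos_eq by exact Hr. ring.
Qed.

Lemma circle_integral_parts (h : C -> C) (r : R) (v : C) :
  is_circle_integral h r v <->
  is_RInt (fun t => Re (h (circle r t) * (Ci * circle r t))%C) 0 (2 * PI) (Re v) /\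
  is_RInt (fun t => Im (h (circle r t) * (Ci * circle r t))%C) 0 (2 * PI) (Im v).
Proof.
split.
- intro H. split.
  + exact (is_RInt_fct_extend_fst (U := R_NormedModule) (V := R_NormedModule) _ _ _ _ H).
  + exact (is_RInt_fct_extend_snd (U := R_NormedModule) (V := R_NormedModule) _ _ _ _ H).
- intros [H1 H2]. destruct v as [v1 v2].
  exact (is_RInt_fct_extend_pair (U := R_NormedModule) (V := R_NormedModule) _ _ _ _ _ H1 H2).
Qed.

Lemma circle_integral_ext (h g : C -> C) (r : R) (v : C) : 0 <= r ->
  (forall z, Cmod z = r -> h z = g z) -> is_circle_integral h r v -> is_circle_integral g r v.
Proof.
intros Hr H. apply is_RInt_ext. intros t _.
change (h (circle r t) * (Ci * circle r t) = g (circle r t) * (Ci * circle r t))%C.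
now rewrite H by now apply Cmod_circle.
Qed.

Lemma circle_integral_unique (h : C -> C) (r : R) (v w : C) :
  is_circle_integral h r v -> is_circle_integral h r w -> v = w.
Proof.
intros Hv Hw. apply circle_integral_parts in Hv. apply circle_integral_parts in Hw.
destruct Hv as [V1 V2], Hw as [W1 W2]. apply injective_projections.
- exact (eq_trans (eq_sym (is_RInt_unique _ _ _ _ V1)) (is_RInt_unique _ _ _ _ W1)).
- exact (eq_trans (eq_sym (is_RInt_unique _ _ _ _ V2)) (is_RInt_unique _ _ _ _ W2)).
Qed.

Lemma circle_integral_lin (a b : C) (h g : C -> C) (r : R) (v w : C) :
  is_circle_integral h r v -> is_circle_integral g r w ->
  is_circle_integral (fun z => a * h z + b * g z)%C r (a * v + b * w)%C.
Proof.
intros Hv Hw. apply circle_integral_parts in Hv. apply circle_integral_parts in Hw.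
destruct Hv as [V1 V2], Hw as [W1 W2].
assert (L : forall p q s u : R, is_RInt (fun t =>
   p * Re (h (circle r t) * (Ci * circle r t))%C + q * Im (h (circle r t) * (Ci * circle r t))%C
   + (s * Re (g (circle r t) * (Ci * circle r t))%C
     + u * Im (g (circle r t) * (Ci * circle r t))%C)) 0 (2 * PI)
   (p * Re v + q * Im v + (s * Re w + u * Im w))).
{ intros p q s u.
  apply (is_RInt_plus (V := R_NormedModule)); apply (is_RInt_plus (V := R_NormedModule));
    now apply (is_RInt_scal (V := R_NormedModule)). }
destruct a as [a1 a2], b as [b1 b2], v as [v1 v2], w as [w1 w2].
apply circle_integral_parts. split.
- replace (Re ((a1, a2) * (v1, v2) + (b1, b2) * (w1, w2))%C) with
    (a1 * v1 + - a2 * v2 + (b1 * w1 + - b2 * w2)) by (unfold Re; simpl; ring).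
  generalize (L a1 (- a2) b1 (- b2)). apply is_RInt_ext. intros t _.
  unfold Re, Im. simpl. ring.
- replace (Im ((a1, a2) * (v1, v2) + (b1, b2) * (w1, w2))%C) with
    (a2 * v1 + a1 * v2 + (b2 * w1 + b1 * w2)) by (unfold Im; simpl; ring).
  generalize (L a2 a1 b2 b1). apply is_RInt_ext. intros t _.
  unfold Re, Im. simpl. ring.
Qed.

Lemma circle_integral_scal (a : C) (h : C -> C) (r : R) (v : C) : 0 <= r ->
  is_circle_integral h r v -> is_circle_integral (fun z => a * h z)%C r (a * v)%C.
Proof.
intros Hr H. generalize (circle_integral_lin a 0 _ _ _ _ _ H H).
replace (a * v + 0 * v)%C with (a * v)%C by ring.
apply circle_integral_ext; [exact Hr|]. intros z _. ring.
Qed.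

Lemma circle_integral_lim (h : nat -> C -> C) (g : C -> C) (eps : nat -> R) (r : R) (v : C) :
  0 <= r -> is_lim_seq eps 0 ->
  (forall n z, Cmod z = r -> Cmod (g z - h n z) <= eps n) ->
  (forall n, is_circle_integral (h n) r v) -> is_circle_integral g r v.
Proof.
intros Hr He Hb Hi.
(* Here [p] stands for [Re] or [Im], of which only the Lipschitz bound is needed. *)
assert (G : forall (p : C -> R) (w : R), (forall x y : C, Rabs (p y - p x) <= Cmod (x - y)) ->
  (forall n, is_RInt (fun t => p (h n (circle r t) * (Ci * circle r t))%C) 0 (2 * PI) w) ->
  is_RInt (fun t => p (g (circle r t) * (Ci * circle r t))%C) 0 (2 * PI) w).
{ intros p w Hp Hw.
  destruct (filterlim_RInt (V := R_CompleteNormedModule)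
    (fun n t => p (h n (circle r t) * (Ci * circle r t))%C) 0 (2 * PI) eventually _
    (fun t => p (g (circle r t) * (Ci * circle r t))%C) (fun _ => w) Hw) as [l [L1 L2]].
  - apply filterlim_locally. intro e.
    (* The factor [Ci * z] contributes [r]; the denominator [r + 1] also covers [r = 0]. *)
    assert (e' : 0 < e / (r + 1)) by (apply Rdiv_lt_0_compat; [apply cond_pos|lra]).
    apply is_lim_seq_spec in He. destruct (He (mkposreal _ e')) as [N HN].
    exists N. intros n Hn t. specialize (HN n Hn). simpl in HN. rewrite Rminus_0_r in HN.
    change (Rabs (p (h n (circle r t) * (Ci * circle r t))%C
      - p (g (circle r t) * (Ci * circle r t))%C) < e).
    apply Rle_lt_trans with (1 := Hp _ _).
    assert (Z := Cmod_circle r t Hr).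
    replace (g (circle r t) * (Ci * circle r t) - h n (circle r t) * (Ci * circle r t))%C
      with ((g (circle r t) - h n (circle r t)) * (Ci * circle r t))%C by ring.
    rewrite !Cmod_mult, Z.
    rewrite Cmod_Ci. specialize (Hb n _ Z).
    assert (T := Rle_abs (eps n)). assert (P := Cmod_ge_0 (g (circle r t) - h n (circle r t))).
    apply Rlt_div_r in HN; [|lra]. assert (Y := Rabs_pos (eps n)).
    assert (Q := Rmult_le_compat_r r _ _ Hr (Rle_trans _ _ _ Hb T)). lra.
  - assert (E : l = w).
    { apply (filterlim_locally_unique (V := R_NormedModule) (F := eventually) (fun _ => w));
        [exact L1|]. apply filterlim_const. }
    now rewrite <- E. }
apply circle_integral_parts. split; apply G.
- intros x y. rewrite <- Rabs_Ropp.
  replace (- (Re y - Re x)) with (Re (x - y)%C) by (destruct x, y; unfold Re; simpl; ring). apply re_le_Cmod.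
- intro n. exact (proj1 (proj1 (circle_integral_parts _ _ _) (Hi n))).
- intros x y. rewrite <- Rabs_Ropp.
  replace (- (Im y - Im x)) with (Im (x - y)%C) by (destruct x, y; unfold Im; simpl; ring). apply im_le_Cmod.
- intro n. exact (proj2 (proj1 (circle_integral_parts _ _ _) (Hi n))).
Qed.

Lemma circle_pow (r t : R) (n : nat) :
  (circle r t ^ n)%C = (r ^ n * cos (INR n * t), r ^ n * sin (INR n * t)).
Proof.
induction n as [|n IH].
- simpl. rewrite Rmult_0_l, cos_0, sin_0. apply injective_projections; simpl; ring.
- simpl Cpow. rewrite IH, S_INR. replace ((INR n + 1) * t) with (INR n * t + t) by ring.
  rewrite cos_plus, sin_plus. unfold circle. apply injective_projections; simpl; ring.
Qed.

Lemma INR_2PI (n : nat) : cos (INR n * (2 * PI)) = 1 /\ sin (INR n * (2 * PI)) = 0.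
Proof.
replace (INR n * (2 * PI)) with (0 + 2 * INR n * PI) by ring.
now rewrite cos_period, sin_period, cos_0, sin_0.
Qed.

Lemma trig_integrals (n : nat) :
  is_RInt (fun t => cos (INR (S n) * t)) 0 (2 * PI) 0 /\
  is_RInt (fun t => sin (INR (S n) * t)) 0 (2 * PI) 0.
Proof.
set (m := INR (S n)). assert (P : 0 < m) by apply lt_0_INR, Nat.lt_0_succ.
destruct (INR_2PI (S n)) as [C1 S1]. fold m in C1, S1.
split.
- evar_last.
  + apply (is_RInt_derive (V := R_CompleteNormedModule) (fun t => sin (m * t) / m)).
    * intros t _. auto_derive; [exact I|field; lra].
    * intros t _. apply (ex_derive_continuous (K := R_AbsRing) (V := R_NormedModule)). auto_derive. exact I.
  + change (sin (m * (2 * PI)) / m - sin (m * 0) / m = 0).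
    rewrite S1, Rmult_0_r, sin_0. field. lra.
- evar_last.
  + apply (is_RInt_derive (V := R_CompleteNormedModule) (fun t => - cos (m * t) / m)).
    * intros t _. auto_derive; [exact I|field; lra].
    * intros t _. apply (ex_derive_continuous (K := R_AbsRing) (V := R_NormedModule)). auto_derive. exact I.
  + change (- cos (m * (2 * PI)) / m - - cos (m * 0) / m = 0).
    rewrite C1, Rmult_0_r, cos_0. field. lra.
Qed.

Lemma circle_integral_pow (r : R) (n : nat) : 0 <= r ->
  is_circle_integral (fun z => z ^ n)%C r 0%C.
Proof.
intro Hr. destruct (trig_integrals n) as [A B].
apply (is_RInt_scal (V := R_NormedModule) _ _ _ (- r ^ S n)) in B.
apply (is_RInt_scal (V := R_NormedModule) _ _ _ (r ^ S n)) in A.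
change scal with Rmult in A, B. rewrite Rmult_0_r in A, B.
assert (E : forall t, (circle r t ^ n * (Ci * circle r t))%C
  = (- r ^ S n * sin (INR (S n) * t), r ^ S n * cos (INR (S n) * t))).
{ intro t. transitivity (Ci * circle r t ^ S n)%C; [simpl Cpow; ring|].
  rewrite circle_pow. apply injective_projections; simpl; ring. }
apply circle_integral_parts. split.
- revert B. apply is_RInt_ext. intros t _. rewrite E. reflexivity.
- revert A. apply is_RInt_ext. intros t _. rewrite E. reflexivity.
Qed.

Lemma circle_neq0 (r t : R) : 0 < r -> circle r t <> 0%C.
Proof. intros Hr E. assert (Z := Cmod_circle r t ltac:(lra)). rewrite E, Cmod_0 in Z. lra. Qed.

Lemma circle_integral_inv (r : R) : 0 < r ->
  is_circle_integral (fun z => / z)%C r (2 * PI * Ci)%C.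
Proof.
intro Hr. apply circle_integral_parts.
assert (E : forall t, (/ circle r t * (Ci * circle r t))%C = Ci).
{ intro t. field. now apply circle_neq0. }
split.
- replace (Re (2 * PI * Ci)%C) with (scal (2 * PI - 0) (Re Ci)).
  + apply is_RInt_ext with (fun _ => Re Ci); [intros t _; now rewrite E|].
    apply (is_RInt_const (V := R_NormedModule)).
  + change scal with Rmult. unfold Re; simpl; ring.
- replace (Im (2 * PI * Ci)%C) with (scal (2 * PI - 0) (Im Ci)).
  + apply is_RInt_ext with (fun _ => Im Ci); [intros t _; now rewrite E|].
    apply (is_RInt_const (V := R_NormedModule)).
  + change scal with Rmult. unfold Im; simpl; ring.
Qed.

Lemma circle_integral_inv_pow (r : R) (n : nat) : 0 < r ->
  is_circle_integral (fun z => (/ z) ^ S (S n))%C r 0%C.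
Proof.
intro Hr. destruct (trig_integrals n) as [A B].
apply (is_RInt_scal (V := R_NormedModule) _ _ _ ((/ r) ^ S n)) in A.
apply (is_RInt_scal (V := R_NormedModule) _ _ _ ((/ r) ^ S n)) in B.
change scal with Rmult in A, B. rewrite Rmult_0_r in A, B.
assert (E : forall t, ((/ circle r t) ^ S (S n) * (Ci * circle r t))%C
  = ((/ r) ^ S n * sin (INR (S n) * t), (/ r) ^ S n * cos (INR (S n) * t))).
{ intro t. assert (Z := circle_neq0 r t Hr).
  assert (I : (/ circle r t)%C = circle (/ r) (- t)).
  { assert (M : (circle r t * circle (/ r) (- t) = 1)%C).
    { unfold circle. rewrite cos_neg, sin_neg. assert (F := sin2_cos2 t). unfold Rsqr in F.
      apply injective_projections; simpl; field_simplify; nra. }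
    transitivity (/ circle r t * (circle r t * circle (/ r) (- t)))%C; [rewrite M; ring|].
    field. exact Z. }
  transitivity (Ci * (/ circle r t) ^ S n)%C; [simpl Cpow; field; exact Z|].
  rewrite I, circle_pow. replace (INR (S n) * - t) with (- (INR (S n) * t)) by ring.
  rewrite cos_neg, sin_neg. apply injective_projections; simpl; ring. }
apply circle_integral_parts. split.
- revert B. apply is_RInt_ext. intros t _. rewrite E. reflexivity.
- revert A. apply is_RInt_ext. intros t _. rewrite E. reflexivity.
Qed.

(** * The resolvent of the backward shift *)

Definition resolvent (lambda : C) : operator := fun f k => (/ lambda * neumann (/ lambda) f k)%C.

Lemma Cmod_inv_lt_1 (lambda : C) : 1 < Cmod lambda -> lambda <> 0%C /\ Cmod (/ lambda) < 1.
Proof.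
intro H. assert (N : lambda <> 0%C) by (intro E; rewrite E, Cmod_0 in H; lra).
split; [exact N|]. rewrite Cmod_inv by exact N. rewrite <- Rinv_1.
apply Rinv_lt_contravar; lra.
Qed.

Lemma neumann_op (beta : nat -> R) (c : C) : admissible_weight beta -> Cmod c < 1 ->
  bounded_operator beta (neumann c).
Proof.
intros H Hc.
destruct (neumann_bounded beta (Cmod c) H (conj (Cmod_ge_0 c) Hc)) as [M HM].
apply (HM c (Rle_refl _)).
Qed.

Lemma resolvent_is_resolvent (beta : nat -> R) (lambda : C) : admissible_weight beta ->
  1 < Cmod lambda -> is_resolvent beta S_beta lambda (resolvent lambda).
Proof.
intros H Hl. destruct (Cmod_inv_lt_1 lambda Hl) as [N L].
assert (B := neumann_op beta (/ lambda) H L).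
split; [|intros f Hf; split].
- generalize (bounded_operator_lin beta _ _ (/ lambda) 0 B B).
  assert (E : (fun f k => / lambda * neumann (/ lambda) f k + 0 * neumann (/ lambda) f k)%C
    = resolvent lambda).
  { apply functional_extensionality. intro f. apply functional_extensionality. intro k.
    unfold resolvent. ring. }
  now rewrite E.
- apply functional_extensionality. intro k. unfold resolvent.
  assert (Hg : H2 beta (fun k => lambda * f k)%C) by now apply H2_scal.
  replace (fun k => lambda * f k - S_beta f k)%C with
    (fun k => lambda * f k - / lambda * S_beta (fun k => lambda * f k)%C k)%C.
  + rewrite (neumann_left beta) by assumption. field. exact N.
  + apply functional_extensionality. intro j. unfold S_beta, PS_decr_1. field. exact N.
- apply functional_extensionality. intro k. unfold resolvent, S_beta, PS_decr_1.
  rewrite (neumann_rec beta (/ lambda) f k H L Hf). field. exact N.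
Qed.

Lemma resolvent_unique (beta : nat -> R) (lambda : C) (Q : operator) (f : nat -> C) :
  admissible_weight beta -> 1 < Cmod lambda -> is_resolvent beta S_beta lambda Q ->
  H2 beta f -> Q f = resolvent lambda f.
Proof.
intros H Hl [_ HQ] Hf. destruct (resolvent_is_resolvent beta lambda H Hl) as [B HR].
rewrite <- (proj2 (HR f Hf)) at 1. apply HQ. now apply B.
Qed.

Definition kernel (omega : C) : nat -> C := fun k => (omega ^ k)%C.

Lemma kernel_H2 (beta : nat -> R) (omega : C) : admissible_weight beta -> unit_disk omega ->
  H2 beta (kernel omega).
Proof.
intros H Ho. unfold unit_disk in Ho. assert (P := Cmod_ge_0 omega).
apply ex_series_ext with (fun k => beta k ^ 2 * (Cmod omega ^ 2) ^ k).
- intro k. unfold kernel. rewrite Cmod_pow, <- !pow_mult, (Nat.mul_comm 2 k). apply Rmult_comm.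
- apply weight_summable; [exact H|]. nra.
Qed.

(* On the kernel at [x] the operator [1 - S_beta] is multiplication by [1 - x]. *)
Lemma spectrum_1 (beta : nat -> R) : admissible_weight beta -> spectrum beta S_beta 1.
Proof.
intros H [Q [[_ [_ [M HM]]] HQ]].
(* So close to [1] that a resolvent of norm at most [M] would satisfy [M * (1 - x) <= / 2], whereas
   it must act on this kernel as division by [1 - x]. *)
set (x := 1 - / (2 * (Rabs M + 1))).
assert (P := Rabs_pos M).
assert (E : (1 - x) * (2 * (Rabs M + 1)) = 1) by (unfold x; field; lra).
assert (X0 : 0 < 1 - x <= / 2).
{ unfold x. replace (1 - (1 - / (2 * (Rabs M + 1)))) with (/ (2 * (Rabs M + 1))) by ring.
  split; [apply Rinv_0_lt_compat; lra|apply Rinv_le_contravar; lra]. }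
assert (U : unit_disk x) by (unfold unit_disk; rewrite Cmod_R, Rabs_pos_eq; lra).
assert (K := kernel_H2 beta x H U).
specialize (HM (fun k => (1 - x)%R * kernel x k)%C (H2_scal _ _ _ K)).
assert (A : (fun k => (1 - x)%R * kernel x k)%C = (fun k => 1 * kernel x k - S_beta (kernel x) k)%C).
{ apply functional_extensionality. intro k. unfold S_beta, PS_decr_1, kernel. simpl Cpow.
  rewrite RtoC_minus. ring. }
rewrite A in HM at 1. rewrite (proj1 (HQ _ K)) in HM.
rewrite !norm2_sqnorm, sqnorm_scal, Cmod_R, Rabs_pos_eq in HM by lra.
assert (N : 0 < sqnorm beta (kernel x)).
{ assert (T := term_le_sqnorm beta _ 0 K). unfold kernel at 1 in T. simpl Cpow in T.
  rewrite Cmod_1, (proj1 (proj2 H)) in T. lra. }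
rewrite sqrt_mult_alt, sqrt_pow2 in HM by (try apply pow2_ge_0; lra).
apply sqrt_lt_R0 in N. assert (T := Rle_abs M). set (n := sqrt _) in *.
assert (T1 : M * (1 - x) <= Rabs M * (1 - x)) by (apply Rmult_le_compat_r; lra).
assert (T2 : M * (1 - x) * n <= / 2 * n) by (apply Rmult_le_compat_r; lra).
lra.
Qed.

(** Since [phi] is total, it has some value at its pole [/ Cconj z0]. Differentiability there would
    still make [phi] bounded nearby, while its modulus blows up along the ray through the pole. *)
Lemma moebius_pole_outside (theta : R) (z0 : C) (phi : C -> C) (r rho : R) :
  unit_disk z0 -> (forall z, phi z = moebius theta z0 z) -> 0 < r < rho ->
  (forall z, Cmod z < rho -> holomorphic_at phi z) -> Cmod z0 * r < 1.
Proof.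
intros H0 Hphi Hr Hol. unfold unit_disk in H0.
destruct (Rlt_le_dec (Cmod z0 * r) 1) as [Y|Y]; [exact Y|exfalso].
assert (P0 : 0 < Cmod z0). { assert (P := Cmod_ge_0 z0). nra. }
set (c := Cconj z0). assert (Mc : Cmod c = Cmod z0) by apply Cmod_conj.
assert (Nc : c <> 0%C) by (intro E; rewrite E, Cmod_0 in Mc; lra).
set (p := (/ c)%C). assert (Mp : Cmod p * Cmod z0 = 1).
{ unfold p. rewrite Cmod_inv, Mc by exact Nc. field. lra. }
assert (Hp : Cmod p < rho) by nra.
destruct (Hol p Hp) as [l [_ Hl]].
specialize (Hl p (fun P HP => HP) (mkposreal 1 Rlt_0_1)).
destruct Hl as [d Hd].
assert (Bd : forall y, Cmod (y - p) < d -> Cmod (phi y) <= Cmod (phi p) + (Cmod l + 1) * d).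
{ intros y Hy. specialize (Hd y Hy).
  assert (L : Cmod (phi y - phi p - (y - p) * l) <= 1 * Cmod (y - p)) by exact Hd.
  replace (phi y) with ((phi y - phi p - (y - p) * l) + (phi p + (y - p) * l))%C by ring.
  apply Rle_trans with (1 := Cmod_triangle _ _).
  assert (T := Cmod_triangle (phi p) ((y - p) * l)). rewrite Cmod_mult in T.
  assert (Q := Cmod_ge_0 l). nra. }
set (B := Cmod (phi p) + (Cmod l + 1) * d) in *.
assert (B0 : 0 < B).
{ assert (Q := Cmod_ge_0 l). assert (Q' := Cmod_ge_0 (phi p)).
  assert (D := cond_pos d). unfold B. nra. }
assert (Pp : 1 < Cmod p) by nra.
set (m := Cmod p - Cmod z0). assert (M0 : 0 < m) by (unfold m; lra).
(* At [y = (1 + e) p] the denominator is exactly [- e] and the numerator has modulus at least [m].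
   The two bounds on [e] keep [y] within [d] of the pole and make [m / e] exceed [B]. *)
set (e := Rmin (d / (2 * Cmod p)) (m / (2 * B))).
assert (E1 : e * Cmod p < d).
{ assert (T := Rmin_l (d / (2 * Cmod p)) (m / (2 * B))). fold e in T.
  apply (Rmult_le_compat_r (Cmod p)) in T; [|lra].
  replace (d / (2 * Cmod p) * Cmod p) with (d / 2) in T by (field; lra).
  assert (D := cond_pos d). lra. }
assert (E2 : B * e < m).
{ assert (T := Rmin_r (d / (2 * Cmod p)) (m / (2 * B))). fold e in T.
  apply (Rmult_le_compat_l B) in T; [|lra].
  replace (B * (m / (2 * B))) with (m / 2) in T by (field; lra). lra. }
assert (E0 : 0 < e).
{ apply Rmin_glb_lt; apply Rdiv_lt_0_compat; try lra. apply cond_pos. }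
set (y := (p + e * p)%C).
assert (Hy : Cmod (y - p) < d).
{ unfold y. replace (p + e * p - p)%C with (e * p)%C by ring.
  rewrite Cmod_mult, Cmod_R, Rabs_pos_eq; lra. }
specialize (Bd y Hy). rewrite Hphi in Bd. unfold moebius in Bd. fold c in Bd.
assert (F : (1 - c * y)%C = (- e)%C) by (unfold y, p; field; exact Nc).
assert (Ne : RtoC e <> 0%C) by (intro E; injection E; lra).
assert (Ne' : (- e)%C <> 0%C) by (intro E; apply Ne; replace (RtoC e) with (- - e)%C by ring; rewrite E; ring).
rewrite F, Cmod_mult, Cmod_cis, Rmult_1_l, Cmod_div, Cmod_opp, Cmod_R, Rabs_pos_eq in Bd
  by (assumption || lra).
apply Rle_div_l in Bd; [|exact E0].
assert (G : m <= Cmod (z0 - y)).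
{ assert (T := Cmod_triangle (y - z0) z0). replace (y - z0 + z0)%C with y in T by ring.
  replace (Cmod (z0 - y)) with (Cmod (y - z0))
    by (rewrite <- Cmod_opp; f_equal; ring).
  assert (Z : Cmod y = (1 + e) * Cmod p).
  { unfold y. replace (p + e * p)%C with (RtoC (1 + e) * p)%C by (rewrite RtoC_plus; ring).
    rewrite Cmod_mult, Cmod_R, Rabs_pos_eq; lra. }
  unfold m. nra. }
lra.
Qed.

Lemma moebius_holomorphic (theta : R) (z0 x : C) (phi : C -> C) :
  (forall z, phi z = moebius theta z0 z) -> (1 - Cconj z0 * x)%C <> 0%C ->
  holomorphic_at phi x.
Proof.
intros Hphi N. set (c := Cconj z0) in *. set (w := (cos theta, sin theta) : C).
exists (w * (c * z0 - 1) / ((1 - c * x) * (1 - c * x)))%C. split.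
{ apply (is_linear_scal_l (K := C_AbsRing) (V := C_NormedModule)). }
intros x' Hx'.
apply (is_filter_lim_locally_unique (K := C_AbsRing) (V := AbsRing_NormedModule C_AbsRing)) in Hx'.
subst x'. intro eps.
set (a := Cmod (1 - c * x)). assert (A0 : 0 < a) by now apply Cmod_gt_0.
(* The remainder of the first-order expansion is exactly [K (y - x)^2 / (1 - c y)]. *)
set (K := (w * (c * z0 - 1) * c / ((1 - c * x) * (1 - c * x)))%C).
assert (C0 := Cmod_ge_0 c). assert (K0 := Cmod_ge_0 K).
(* The first bound keeps the denominator above [a / 2], the second makes the remainder at most
   [eps * Cmod (y - x)]. *)
set (d := Rmin (a / (2 * (Cmod c + 1))) (eps * a / (2 * (Cmod K + 1)))).
assert (D0 : 0 < d).
{ apply Rmin_glb_lt; apply Rdiv_lt_0_compat; try lra.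
  apply Rmult_lt_0_compat; [apply cond_pos|exact A0]. }
assert (D1 : d * (2 * (Cmod c + 1)) <= a).
{ apply Rle_div_r; [lra|]. apply Rmin_l. }
assert (D2 : d * (2 * (Cmod K + 1)) <= eps * a).
{ apply Rle_div_r; [lra|]. apply Rmin_r. }
exists (mkposreal d D0). intros y Hy.
change (Cmod (y - x) < d) in Hy.
change (Cmod (phi y - phi x - (y - x) * (w * (c * z0 - 1) / ((1 - c * x) * (1 - c * x))))
  <= eps * Cmod (y - x)).
assert (Y0 := Cmod_ge_0 (y - x)).
assert (Ay : a / 2 <= Cmod (1 - c * y)).
{ assert (T := Cmod_triangle (1 - c * y) (c * (y - x))). rewrite Cmod_mult in T.
  replace (1 - c * y + c * (y - x))%C with (1 - c * x)%C in T by ring. fold a in T. nra. }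
assert (Ny : (1 - c * y)%C <> 0%C) by (intro E; rewrite E, Cmod_0 in Ay; lra).
rewrite !Hphi. unfold moebius. fold c w.
replace (w * ((z0 - y) / (1 - c * y)) - w * ((z0 - x) / (1 - c * x))
    - (y - x) * (w * (c * z0 - 1) / ((1 - c * x) * (1 - c * x))))%C
  with (K * (y - x) / (1 - c * y) * (y - x))%C by (unfold K; field; split; assumption).
rewrite Cmod_mult, Cmod_div, Cmod_mult by exact Ny.
apply Rmult_le_compat_r; [exact Y0|]. apply Rle_div_l; [lra|].
assert (Ep := cond_pos eps).
apply Rle_trans with (Cmod K * d); [apply Rmult_le_compat_l; lra|].
apply Rle_trans with (eps * (a / 2)); [nra|]. apply Rmult_le_compat_l; lra.
Qed.

(** * The functional calculus of a disk automorphism *)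

Lemma resolvent_step (beta : nat -> R) (lambda : C) (u : nat -> C) :
  admissible_weight beta -> 1 < Cmod lambda -> H2 beta u ->
  resolvent lambda u = (fun k => / lambda * u k + / lambda * resolvent lambda (S_beta u) k)%C.
Proof.
intros H Hl Hu. destruct (Cmod_inv_lt_1 lambda Hl) as [N L].
apply functional_extensionality. intro k. unfold resolvent.
rewrite (neumann_rec beta) by assumption. rewrite neumann_S. unfold S_beta, PS_decr_1. ring.
Qed.

Lemma resolvent_H2 (beta : nat -> R) (lambda : C) (u : nat -> C) :
  admissible_weight beta -> 1 < Cmod lambda -> H2 beta u -> H2 beta (resolvent lambda u).
Proof. intros H Hl Hu. now apply (resolvent_is_resolvent beta lambda H Hl). Qed.

Lemma resolvent_inner_step (beta : nat -> R) (lambda : C) (u g : nat -> C) :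
  admissible_weight beta -> 1 < Cmod lambda -> H2 beta u -> H2 beta g ->
  inner beta (resolvent lambda u) g
    = (/ lambda * inner beta u g + / lambda * inner beta (resolvent lambda (S_beta u)) g)%C.
Proof.
intros H Hl Hu Hg. rewrite (resolvent_step beta) by assumption.
apply inner_lin; [exact Hu| |exact Hg]. apply resolvent_H2; trivial. now apply H2_S.
Qed.

(* Partial sums of the Laurent series [sum_n lambda^(-n-1) <S_beta^n u, g>]
   of the resolvent. *)
Fixpoint laurent (beta : nat -> R) (g : nat -> C) (n : nat) (u : nat -> C) (lambda : C) : C :=
  match n with
  | O => 0
  | S n => / lambda * inner beta u g + / lambda * laurent beta g n (S_beta u) lambda
  end.

(** Only the power [z^(-1)] has a nonzero integral. The extra factor [(/ z) ^ m] makes the induction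
    go through: peeling off the leading term turns [m] into [S m], and the rest integrates to
    [0]. *)
Lemma laurent_integral (beta : nat -> R) (g : nat -> C) (r : R) (n m : nat) (u : nat -> C) :
  0 < r ->
  is_circle_integral (fun z => (/ z) ^ m * laurent beta g (S n) u z)%C r
    (if Nat.eqb m 0 then 2 * PI * Ci * inner beta u g else 0)%C.
Proof.
intro Hr.
assert (P : forall m, is_circle_integral (fun z => (/ z) ^ S m)%C r
  (if Nat.eqb m 0 then 2 * PI * Ci else 0)%C).
{ intros [|i]; [|now apply circle_integral_inv_pow].
  generalize (circle_integral_inv r Hr). apply circle_integral_ext; [lra|].
  intros z _. simpl. ring. }
revert m u. induction n as [|n IH]; intros m u.
- assert (A := circle_integral_scal (inner beta u g) _ r _ ltac:(lra) (P m)).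
  replace (if Nat.eqb m 0 then 2 * PI * Ci * inner beta u g else 0)%C with
    (inner beta u g * (if Nat.eqb m 0 then 2 * PI * Ci else 0))%C
    by (destruct (Nat.eqb m 0); ring).
  revert A. apply circle_integral_ext; [lra|]. intros z _. simpl. ring.
- assert (B := circle_integral_lin (inner beta u g) 1 _ _ _ _ _ (P m) (IH (S m) (S_beta u))).
  simpl (Nat.eqb (S m) 0) in B. cbv iota in B.
  replace (if Nat.eqb m 0 then 2 * PI * Ci * inner beta u g else 0)%C with
    (inner beta u g * (if Nat.eqb m 0 then 2 * PI * Ci else 0) + 1 * 0)%C
    by (destruct (Nat.eqb m 0); ring).
  revert B. apply circle_integral_ext; [lra|].
  intros z _. change (laurent beta g (S (S n)) u z) with
    (/ z * inner beta u g + / z * laurent beta g (S n) (S_beta u) z)%C. simpl Cpow. ring.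
Qed.

Lemma laurent_remainder (beta : nat -> R) (g : nat -> C) (n : nat) (u : nat -> C) (lambda : C) :
  admissible_weight beta -> 1 < Cmod lambda -> H2 beta u -> H2 beta g ->
  (inner beta (resolvent lambda u) g - laurent beta g n u lambda
    = (/ lambda) ^ n * inner beta (resolvent lambda (shift n u)) g)%C.
Proof.
intros H Hl Hu Hg. revert u Hu. induction n as [|n IH]; intros u Hu.
- replace (shift 0 u) with u by (apply functional_extensionality; intro k;
    unfold shift; now rewrite Nat.add_0_r).
  simpl. ring.
- simpl laurent. rewrite (resolvent_inner_step beta) by assumption.
  replace (shift (S n) u) with (shift n (S_beta u)) by (apply functional_extensionality; intro k;
    unfold shift, S_beta, PS_decr_1; f_equal; lia).
  simpl Cpow. rewrite <- Cmult_assoc, <- IH by now apply H2_S. ring.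
Qed.

(** This is the functional calculus of the constant function [1], obtained by integrating the
    Laurent series of the resolvent. The growth [r^N] of [||S^N u||^2] loses against [r^(-2N)], so
    the remainder tends to [0] uniformly on the circle. *)
Lemma resolvent_integral (beta : nat -> R) (r : R) (u g : nat -> C) :
  admissible_weight beta -> 1 < r -> H2 beta u -> H2 beta g ->
  is_circle_integral (fun z => inner beta (resolvent z u) g) r
    (2 * PI * Ci * inner beta u g)%C.
Proof.
intros H Hr Hu Hg.
assert (Ir : 0 < / r < 1).
{ split; [apply Rinv_0_lt_compat; lra|]. rewrite <- Rinv_1. apply Rinv_lt_contravar; lra. }
destruct (neumann_bounded beta (/ r) H ltac:(lra)) as [M HM].
destruct (shift_sqnorm beta r H Hr) as [P HP].
set (K := Rmax 0 M * (P * sqnorm beta u)).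
set (G := sqnorm beta g).
(* The remainder has squared norm at most [K x^(2N)]; taking [tau = x^N] in [inner_bound] makes both
   of its terms of order [x^N]. *)
set (x := sqrt (/ r)).
assert (X2 : x ^ 2 = / r) by (apply pow2_sqrt; lra).
assert (X0 : 0 < x) by (apply sqrt_lt_R0; lra).
assert (X1 : x < 1) by (rewrite <- sqrt_1; apply sqrt_lt_1; lra).
apply (circle_integral_lim (fun n z => laurent beta g (S n) u z) _
  (fun n => (K + G) * x ^ S n)); [lra| | |].
- replace (Finite 0) with (Finite ((K + G) * 0)) by (f_equal; ring).
  apply is_lim_seq_mult'; [apply is_lim_seq_const|].
  apply -> (is_lim_seq_incr_1 (fun n => x ^ n)). apply is_lim_seq_geom.
  rewrite Rabs_pos_eq; lra.
- intros n z Hz. set (N := S n).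
  assert (Z1 : 1 < Cmod z) by lra. destruct (Cmod_inv_lt_1 z Z1) as [Nz _].
  assert (Iz : Cmod (/ z) = / r) by (rewrite Cmod_inv by exact Nz; now rewrite Hz).
  rewrite laurent_remainder by assumption.
  destruct (HP N u Hu) as [Hs Bs].
  destruct (HM (/ z)%C ltac:(lra)) as [[Bn _] Nn].
  assert (Hn := Bn _ Hs). specialize (Nn _ Hs).
  assert (S0 := sqnorm_nonneg beta _ Hs).
  assert (Hv : H2 beta (resolvent z (shift N u))) by now apply resolvent_H2.
  rewrite <- inner_scal by assumption.
  set (v := fun k => ((/ z) ^ N * resolvent z (shift N u) k)%C).
  assert (Hvv : H2 beta v) by now apply H2_scal.
  assert (T : 0 < x ^ N) by now apply pow_lt.
  apply Rle_trans with (1 := inner_bound beta (x ^ N) v g T Hvv Hg).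
  fold G. rewrite Rmult_plus_distr_r, (Rmult_comm G).
  apply Rplus_le_compat_r.
  assert (Nv : sqnorm beta v <= K * (x ^ N) ^ 2).
  { unfold v. rewrite sqnorm_scal. unfold resolvent. rewrite sqnorm_scal.
    rewrite Cmod_pow, Iz, <- X2.
    assert (W : sqnorm beta (neumann (/ z) (shift N u)) <= K * r ^ N).
    { apply Rle_trans with (1 := Nn).
      apply Rle_trans with (Rmax 0 M * sqnorm beta (shift N u)).
      - apply Rmult_le_compat_r; [exact S0|apply Rmax_r].
      - unfold K. replace (Rmax 0 M * (P * sqnorm beta u) * r ^ N) with
          (Rmax 0 M * (P * r ^ N * sqnorm beta u)) by ring.
        apply Rmult_le_compat_l; [apply Rmax_l|exact Bs]. }
    assert (W0 := sqnorm_nonneg beta _ Hn).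
    set (y := sqnorm beta (neumann (/ z) (shift N u))) in *.
    assert (Q : r ^ N * ((x ^ 2) ^ N * (x ^ 2) ^ N) = (x ^ N) ^ 2).
    { rewrite X2 at 1. rewrite <- Rmult_assoc, <- Rpow_mult_distr, Rinv_r, pow1 by lra.
      rewrite <- !pow_mult, Nat.mul_comm. ring. }
    assert (V : (x ^ 2) ^ 2 <= 1).
    { rewrite X2. simpl. nra. }
    assert (V0 := pow2_ge_0 (x ^ 2)).
    apply Rle_trans with (((x ^ 2) ^ N) ^ 2 * (1 * y)).
    - apply Rmult_le_compat_l; [apply pow2_ge_0|]. apply Rmult_le_compat_r; lra.
    - rewrite <- Q. replace (K * (r ^ N * ((x ^ 2) ^ N * (x ^ 2) ^ N))) with
        (((x ^ 2) ^ N) ^ 2 * (K * r ^ N)) by ring.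
      apply Rmult_le_compat_l; [apply pow2_ge_0|lra]. }
  apply (Rmult_le_reg_l (x ^ N)); [exact T|].
  rewrite <- Rmult_assoc, Rinv_r, Rmult_1_l by lra. lra.
- intro n. generalize (laurent_integral beta g r n 0 u ltac:(lra)). simpl Nat.eqb. cbv iota.
  apply circle_integral_ext; [lra|]. intros z _. simpl Cpow. ring.
Qed.

Fixpoint geometric (c : C) (n : nat) (z : C) : C :=
  match n with
  | O => 0
  | S n => 1 + c * z * geometric c n z
  end.

Lemma geometric_integral (c : C) (r : R) (n m : nat) : 0 < r ->
  is_circle_integral (fun z => z ^ m * geometric c n z)%C r 0%C.
Proof.
intro Hr. revert m. induction n as [|n IH]; intro m.
- generalize (circle_integral_scal 0 _ _ _ (Rlt_le _ _ Hr) (circle_integral_pow r 0 (Rlt_le _ _ Hr))).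
  rewrite Cmult_0_r. apply circle_integral_ext; [lra|]. intros z _. simpl. ring.
- assert (B := circle_integral_lin 1 c _ _ _ _ _ (circle_integral_pow r m (Rlt_le _ _ Hr)) (IH (S m))).
  replace (1 * 0 + c * 0)%C with (RtoC 0) in B by ring.
  revert B. apply circle_integral_ext; [lra|]. intros z _. simpl. ring.
Qed.

(** The geometric series of [1 / (1 - conj(z0) z)] converges uniformly on the circle, because
    [Cmod z0 * r < 1], and its partial sums give polynomials, whose integrals vanish. *)
Lemma moebius_integral (theta : R) (z0 : C) (r : R) : 0 < r -> Cmod z0 * r < 1 ->
  is_circle_integral (moebius theta z0) r 0%C.
Proof.
intros Hr H0. set (c := Cconj z0). assert (Mc : Cmod c = Cmod z0) by apply Cmod_conj.
assert (P0 := Cmod_ge_0 z0).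
set (w := (cos theta, sin theta) : C).
assert (D : forall z, Cmod z = r -> 1 - Cmod z0 * r <= Cmod (1 - c * z)).
{ intros z Hz. assert (T := Cmod_triangle (1 - c * z) (c * z)).
  rewrite Cmod_mult, Mc, Hz in T. replace (1 - c * z + c * z)%C with (RtoC 1) in T by ring.
  rewrite Cmod_1 in T. lra. }
set (x := Cmod z0 * r) in *. assert (X0 : 0 <= x) by (apply Rmult_le_pos; lra).
apply (circle_integral_lim (fun n z => w * (z0 - z) * geometric c n z)%C _
  (fun n => (Cmod z0 + r) / (1 - x) * x ^ n)); [lra| | |].
- replace (Finite 0) with (Finite ((Cmod z0 + r) / (1 - x) * 0)) by (f_equal; ring).
  apply is_lim_seq_mult'; [apply is_lim_seq_const|].
  apply is_lim_seq_geom. rewrite Rabs_pos_eq; lra.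
- intros n z Hz. specialize (D z Hz).
  assert (N : (1 - c * z)%C <> 0%C) by (intro E; rewrite E, Cmod_0 in D; lra).
  assert (R : (/ (1 - c * z) - geometric c n z = (c * z) ^ n / (1 - c * z))%C).
  { induction n as [|n IH]; [simpl; field; exact N|]. simpl geometric. simpl Cpow.
    replace (geometric c n z) with (/ (1 - c * z) - (/ (1 - c * z) - geometric c n z))%C by ring.
    rewrite IH. field. exact N. }
  unfold moebius. fold c w.
  replace (w * ((z0 - z) / (1 - c * z)) - w * (z0 - z) * geometric c n z)%C with
    (w * (z0 - z) * (/ (1 - c * z) - geometric c n z))%C by (field; exact N).
  rewrite R, !Cmod_mult, Cmod_div, Cmod_pow, Cmod_mult, Mc, Hz by exact N. fold x.
  unfold w. rewrite Cmod_cis, Rmult_1_l.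
  assert (T := Cmod_triangle z0 (- z)). rewrite Cmod_opp, Hz in T.
  assert (Xn := pow_le x n X0).
  unfold Rdiv. rewrite Rmult_assoc, (Rmult_comm (/ _)).
  apply Rmult_le_compat; [apply Cmod_ge_0| |exact T|].
  + apply Rdiv_le_0_compat; lra.
  + apply Rmult_le_compat_l; [exact Xn|]. apply Rinv_le_contravar; lra.
- intro n. assert (A := circle_integral_lin (w * z0) (- w) _ _ _ _ _
    (geometric_integral c r n 0 Hr) (geometric_integral c r n 1 Hr)).
  replace (w * z0 * 0 + - w * 0)%C with (RtoC 0) in A by ring.
  revert A. apply circle_integral_ext; [lra|]. intros z _. simpl. ring.
Qed.

Definition moebius_op (theta : R) (z0 : C) : operator := fun f k =>
  ((cos theta, sin theta) * z0 * neumann (Cconj z0) f k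
    + - (cos theta, sin theta) * S_beta (neumann (Cconj z0) f) k)%C.

Lemma moebius_op_bounded (beta : nat -> R) (theta : R) (z0 : C) :
  admissible_weight beta -> unit_disk z0 -> bounded_operator beta (moebius_op theta z0).
Proof.
intros H H0.
assert (B : bounded_operator beta (neumann (Cconj z0)))
  by (apply neumann_op; [exact H|now rewrite Cmod_conj]).
exact (bounded_operator_lin beta _ _ _ _ B
  (bounded_operator_comp beta _ _ (S_beta_bounded beta H) B)).
Qed.

(** For [f = (1 - c S) u] the identity [R(z) S u = z R(z) u - u] gives [phi(z) R(z) f = e^(i theta)
    (z0 - z) R(z) u + c phi(z) u], with [R(z)] the resolvent. The factor [z R(z) u] becomes
    [R(z) S u + u], so only integrals of resolvents, of [phi] and of a constant remain. *)
Lemma moebius_calculus (beta : nat -> R) (theta : R) (z0 : C) (r : R) (f g : nat -> C) :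
  admissible_weight beta -> unit_disk z0 -> 1 < r -> Cmod z0 * r < 1 ->
  H2 beta f -> H2 beta g ->
  is_circle_integral (fun z => moebius theta z0 z * inner beta (resolvent z f) g)%C r
    (2 * PI * Ci * inner beta (moebius_op theta z0 f) g)%C.
Proof.
intros H H0 Hr Hz0 Hf Hg. set (c := Cconj z0). assert (Mc : Cmod c = Cmod z0) by apply Cmod_conj.
set (w := (cos theta, sin theta) : C).
assert (C1 : Cmod c < 1) by (rewrite Mc; exact H0).
set (u := neumann c f).
assert (Hu : H2 beta u) by now apply (neumann_op beta c H C1).
assert (Hv := H2_S beta u H Hu).
assert (Ef : f = (fun k => 1 * u k + (- c) * S_beta u k)%C).
{ apply functional_extensionality. intro k. unfold u. rewrite (neumann_rec beta) by assumption.
  unfold S_beta, PS_decr_1. ring. }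
assert (I1 := resolvent_integral beta r u g H Hr Hu Hg).
assert (I2 := resolvent_integral beta r _ g H Hr Hv Hg).
assert (I3 := moebius_integral theta z0 r ltac:(lra) Hz0).
assert (I4 := circle_integral_pow r 0 ltac:(lra)).
assert (J := circle_integral_lin 1 1 _ _ _ _ _
  (circle_integral_lin (w * z0) (- w) _ _ _ _ _ I1 I2)
  (circle_integral_lin (c * inner beta u g) (- w * inner beta u g) _ _ _ _ _ I3 I4)).
replace (2 * PI * Ci * inner beta (moebius_op theta z0 f) g)%C with
  (1 * (w * z0 * (2 * PI * Ci * inner beta u g) + - w * (2 * PI * Ci * inner beta (S_beta u) g))
    + 1 * (c * inner beta u g * 0 + - w * inner beta u g * 0))%C.
- revert J. apply circle_integral_ext; [lra|]. intros z Hz.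
  assert (Z1 : 1 < Cmod z) by lra. destruct (Cmod_inv_lt_1 z Z1) as [Nz _].
  assert (D : (1 - c * z)%C <> 0%C).
  { intro E. assert (T : Cmod (c * z) = 1).
    { replace (c * z)%C with (1 - (1 - c * z))%C by ring. rewrite E.
      replace (1 - 0)%C with (RtoC 1) by ring. apply Cmod_1. }
    rewrite Cmod_mult, Mc, Hz in T. lra. }
  assert (Hru := resolvent_H2 beta z u H Z1 Hu).
  assert (Hrv := resolvent_H2 beta z _ H Z1 Hv).
  assert (Er : resolvent z f = (fun k => 1 * resolvent z u k + - c * resolvent z (S_beta u) k)%C).
  { rewrite Ef at 1. destruct (resolvent_is_resolvent beta z H Z1) as [[_ [L _]] _].
    now apply L. }
  assert (Es := resolvent_inner_step beta z u g H Z1 Hu Hg).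
  rewrite Er, inner_lin by assumption.
  set (a := inner beta (resolvent z (S_beta u)) g) in *.
  rewrite Es. simpl Cpow. unfold moebius. fold c w. field. split; assumption.
- unfold moebius_op. fold c w u. rewrite inner_lin by assumption. ring.
Qed.

Lemma hol_calculus_exists (beta : nat -> R) (phi : C -> C) (theta : R) (z0 : C) :
  admissible_weight beta -> unit_disk z0 -> (forall z, phi z = moebius theta z0 z) ->
  is_hol_calculus beta S_beta phi (moebius_op theta z0).
Proof.
intros H H0 Hphi. split; [now apply moebius_op_bounded|].
unfold unit_disk in H0. assert (P := Cmod_ge_0 z0). set (a := Cmod z0) in *.
(* A radius strictly between the unit circle and the pole, as [a * rho < 1]. *)
set (rho := 2 / (1 + a)).
assert (E : rho * (1 + a) = 2) by (unfold rho; field; lra).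
assert (R1 : 1 < rho) by nra. assert (R2 : a * rho < 1) by nra.
exists ((1 + rho) / 2), rho, resolvent. set (r := (1 + rho) / 2).
assert (R3 : 1 < r < rho) by (unfold r; lra).
split; [lra|split; [|split; [|split]]].
- intros lambda Hs. apply Rnot_le_lt. intro L. apply Hs. exists (resolvent lambda).
  apply resolvent_is_resolvent; [exact H|lra].
- intros z Hz. apply moebius_holomorphic with (1 := Hphi). intro E0.
  assert (T : Cmod (Cconj z0 * z) = 1).
  { replace (Cconj z0 * z)%C with (1 - (1 - Cconj z0 * z))%C by ring. rewrite E0.
    replace (1 - 0)%C with (RtoC 1) by ring. apply Cmod_1. }
  rewrite Cmod_mult, Cmod_conj in T. fold a in T. assert (Z := Cmod_ge_0 z). nra.
- intros lambda Hl. apply resolvent_is_resolvent; [exact H|lra].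
- intros f g Hf Hg.
  apply circle_integral_ext with
    (h := fun z => (moebius theta z0 z * inner beta (resolvent z f) g)%C); [lra| |].
  + intros z _. now rewrite Hphi.
  + apply moebius_calculus; trivial; [lra|]. fold a. nra.
Qed.

(** The radius and the resolvents witnessing the calculus for [A] are arbitrary. They are shown to
    be admissible for the explicit computation, so both operators have the same weak integral over
    the same circle. *)
Lemma hol_calculus_unique (beta : nat -> R) (phi : C -> C) (theta : R) (z0 : C) (A : operator) :
  admissible_weight beta -> unit_disk z0 -> (forall z, phi z = moebius theta z0 z) ->
  is_hol_calculus beta S_beta phi A ->
  forall f, H2 beta f -> A f = moebius_op theta z0 f.
Proof.
intros H H0 Hphi [[BA _] [r [rho [Q [Hr [Hs [Hol [HQ HI]]]]]]]] f Hf.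
assert (R1 := Hs 1%C (spectrum_1 beta H)). rewrite Cmod_1 in R1.
assert (Rz := moebius_pole_outside theta z0 phi r rho H0 Hphi Hr Hol).
assert (HB : H2 beta (moebius_op theta z0 f)) by now apply moebius_op_bounded.
(* Testing against the difference itself gives [inner beta d d = 0], hence [d = 0]. *)
set (d := fun k => (1 * A f k + (- (1)) * moebius_op theta z0 f k)%C).
assert (Hd : H2 beta d) by (apply H2_lin; auto).
assert (E : (2 * PI * Ci * inner beta (A f) d = 2 * PI * Ci * inner beta (moebius_op theta z0 f) d)%C).
{ apply (circle_integral_unique _ _ _ _ (HI f d Hf Hd)).
  generalize (moebius_calculus beta theta z0 r f d H H0 R1 Rz Hf Hd).
  apply circle_integral_ext; [lra|]. intros z Hz. rewrite Hphi.
  rewrite (resolvent_unique beta z (Q z) f); trivial; [lra|]. now apply HQ. }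
assert (N : (2 * PI * Ci)%C <> 0%C).
{ intro F. assert (P := PI_RGT_0). apply (f_equal snd) in F. simpl in F. lra. }
set (K := (2 * PI * Ci)%C) in *. clearbody K.
assert (E' : inner beta (A f) d = inner beta (moebius_op theta z0 f) d).
{ transitivity (/ K * (K * inner beta (A f) d))%C; [field; exact N|].
  rewrite E. field. exact N. }
assert (Z : inner beta d d = 0%C).
{ unfold d at 1. rewrite inner_lin by auto. rewrite E'. ring. }
assert (S : sqnorm beta d <= 0).
{ right. assert (T := norm2_sqnorm beta d). unfold norm2 in T. rewrite Z in T.
  simpl in T. rewrite sqrt_0 in T. symmetry in T.
  apply sqrt_eq_0; [|exact T]. now apply sqnorm_nonneg. }
assert (D := sqnorm_zero beta d (proj1 H) Hd S).
apply functional_extensionality. intro k. specialize (D k). unfold d in D.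
replace (A f k) with (1 * A f k + - (1) * moebius_op theta z0 f k + moebius_op theta z0 f k)%C by ring.
rewrite D. ring.
Qed.

(** * Similarity of the kernel bundles *)

Lemma linear_on_scal (beta : nat -> R) (T : operator) (a : C) (f : nat -> C) :
  linear_on beta T -> H2 beta f -> T (fun k => a * f k)%C = (fun k => a * T f k)%C.
Proof.
intros L Hf.
replace (fun k => a * f k)%C with (fun k => a * f k + 0 * f k)%C
  by (apply functional_extensionality; intro; ring).
rewrite L by assumption. apply functional_extensionality. intro. ring.
Qed.

Lemma bounded_linear (beta : nat -> R) (T : operator) :
  bounded_operator beta T -> linear_on beta T.
Proof. now intros [_ [L _]]. Qed.

Lemma Cmod_lt_neq (a b : C) : Cmod a < Cmod b -> (b - a)%C <> 0%C.
Proof.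
intros H E. assert (T : b = a) by (replace b with (b - a + a)%C by ring; rewrite E; ring).
rewrite T in H. lra.
Qed.

(** On an eigenvector of [S_beta] the intertwining relation becomes a two-term recursion in [k] with
    ratio [psi_s(eta)]. It starts from [1], since row [0] of the matrix is the constant series. *)
Lemma comp_op_kernel (beta : nat -> R) (s : R) (eta : C) : admissible_weight beta ->
  Rabs s < 1 -> unit_disk eta ->
  comp_op s (kernel eta) = kernel ((eta + s) / (1 + s * eta)).
Proof.
intros H Hs He. assert (K := kernel_H2 beta eta H He). unfold unit_disk in He.
assert (L := comp_op_linear beta s H Hs).
assert (D : (1 + s * eta)%C <> 0%C).
{ replace (1 + s * eta)%C with (1 - - (s * eta))%C by ring. apply Cmod_lt_neq.
  rewrite Cmod_1, Cmod_opp, Cmod_mult, Cmod_R.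
  assert (P := Cmod_ge_0 eta). assert (Q := Rabs_pos s). nra. }
assert (R : forall k, ((1 + s * eta) * comp_op s (kernel eta) (S k)
  = (eta + s) * comp_op s (kernel eta) k)%C).
{ intro k. assert (I := comp_op_intertwine beta s _ H Hs K k).
  replace (fun i => kernel eta i + s * S_beta (kernel eta) i)%C
    with (fun i => (1 + s * eta) * kernel eta i)%C in I
    by (apply functional_extensionality; intro i; unfold S_beta, PS_decr_1, kernel; simpl; ring).
  replace (fun i => S_beta (kernel eta) i + s * kernel eta i)%C
    with (fun i => (eta + s) * kernel eta i)%C in I
    by (apply functional_extensionality; intro i; unfold S_beta, PS_decr_1, kernel; simpl; ring).
  rewrite !(linear_on_scal beta) in I by assumption. exact I. }
apply functional_extensionality. intro k. induction k as [|k IH].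
- rewrite comp_op_0. reflexivity.
- assert (E : comp_op s (kernel eta) (S k)
    = ((eta + s) / (1 + s * eta) * comp_op s (kernel eta) k)%C).
  { transitivity (/ (1 + s * eta) * ((1 + s * eta) * comp_op s (kernel eta) (S k)))%C;
      [field; exact D|]. rewrite R. field. exact D. }
  rewrite E, IH. reflexivity.
Qed.

(* [comp_op (- s) o comp_op s] commutes with the shift and keeps the coefficient of
   index [0], so it is the identity. *)
Lemma comp_op_inverse (beta : nat -> R) (s : R) (f : nat -> C) : admissible_weight beta ->
  polynomial_growth beta -> Rabs s < 1 -> H2 beta f -> comp_op (- s) (comp_op s f) = f.
Proof.
intros H Hg Hs Hf. assert (Hs' : Rabs (- s) < 1) by now rewrite Rabs_Ropp.
assert (B := comp_op_bounded beta s H Hg Hs).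
assert (L := bounded_linear _ _ B). assert (L' := comp_op_linear beta (- s) H Hs').
set (T := comp_op s) in *. set (T' := comp_op (- s)) in *.
assert (D : (1 - s * s)%C <> 0%C).
{ apply Cmod_lt_neq. rewrite Cmod_1, Cmod_mult, Cmod_R. assert (Q := Rabs_pos s). nra. }
assert (W : forall p, H2 beta p -> forall k, T' (T p) (S k) = T' (T (S_beta p)) k).
{ intros p Hp k. assert (Hp' := H2_S beta p H Hp).
  (* Chosen so that [v - s S v = (1 - s^2) T p] and [S v - s v = (1 - s^2) T (S p)], the two
     arguments of the intertwining relation for [- s]. *)
  set (v := T (fun i => 1 * p i + s * S_beta p i)%C).
  assert (Hv : H2 beta v) by (apply B, H2_lin; assumption).
  assert (Sv : S_beta v = (fun i => 1 * T (S_beta p) i + s * T p i)%C).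
  { rewrite <- L by assumption. apply functional_extensionality. intro i.
    assert (I := comp_op_intertwine beta s p H Hs Hp i). fold T in I.
    replace (fun i => 1 * S_beta p i + s * p i)%C with (fun i => S_beta p i + s * p i)%C
      by (apply functional_extensionality; intro; ring).
    rewrite <- I. unfold S_beta at 1, PS_decr_1 at 1, v. do 2 f_equal.
    apply functional_extensionality. intro. ring. }
  assert (Ev : v = (fun i => 1 * T p i + s * T (S_beta p) i)%C) by (unfold v; now apply L).
  assert (I := comp_op_intertwine beta (- s) v H Hs' Hv k). fold T' in I.
  replace (fun i => v i + (- s)%R * S_beta v i)%C with (fun i => (1 - s * s) * T p i)%C in I.
  2: { apply functional_extensionality. intro i. rewrite Sv, Ev, RtoC_opp. ring. }
  replace (fun i => S_beta v i + (- s)%R * v i)%C with (fun i => (1 - s * s) * T (S_beta p) i)%C in I.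
  2: { apply functional_extensionality. intro i. rewrite Sv, Ev, RtoC_opp. ring. }
  rewrite !(linear_on_scal beta) in I by (trivial; now apply B).
  transitivity (/ (1 - s * s) * ((1 - s * s) * T' (T p) (S k)))%C; [field; exact D|].
  rewrite I. field. exact D. }
apply functional_extensionality. intro k. revert f Hf.
induction k as [|k IH]; intros f Hf.
- unfold T', T. now rewrite !comp_op_0.
- rewrite W by exact Hf. now rewrite IH by now apply H2_S.
Qed.

Definition diag (a : C) : operator := fun f k => (a ^ k * f k)%C.

Lemma diag_bounded (beta : nat -> R) (a : C) : Cmod a = 1 -> bounded_operator beta (diag a).
Proof.
intro Ha.
assert (E : forall f k, Cmod (diag a f k) ^ 2 * beta k ^ 2 = Cmod (f k) ^ 2 * beta k ^ 2).
{ intros f k. unfold diag. rewrite Cmod_mult, Cmod_pow, Ha, pow1. ring. }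
apply (bounded_operator_partial_sums beta _ 1).
- intros c d f g _ _. apply functional_extensionality. intro k. unfold diag. ring.
- intros f n Hf. rewrite (sum_n_eq _ _ n (E f)), Rmult_1_l.
  exact (sum_n_le_Series _ (sqterm_nonneg beta f) Hf n).
Qed.

Lemma Cpow_mul (a b : C) (k : nat) : ((a * b) ^ k = a ^ k * b ^ k)%C.
Proof. induction k as [|k IH]; simpl; [ring|]. rewrite IH. ring. Qed.

Lemma diag_kernel (a omega : C) : diag a (kernel omega) = kernel (a * omega).
Proof. apply functional_extensionality. intro k. unfold diag, kernel. now rewrite Cpow_mul. Qed.

Lemma diag_inverse (a b : C) (f : nat -> C) : (a * b)%C = 1%C -> diag a (diag b f) = f.
Proof.
intro E. apply functional_extensionality. intro k. unfold diag.
rewrite Cmult_assoc, <- Cpow_mul, E.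
assert (O : (1 ^ k)%C = 1%C) by (induction k as [|k IH]; simpl; [reflexivity|rewrite IH; ring]).
rewrite O. ring.
Qed.

Lemma S_beta_eigenvector (mu : C) (f : nat -> C) :
  (forall k, S_beta f k = (mu * f k)%C) -> f = (fun k => f 0%nat * kernel mu k)%C.
Proof.
intro H. apply functional_extensionality. intro k. unfold kernel.
induction k as [|k IH]; [simpl; ring|]. unfold S_beta, PS_decr_1 in H.
rewrite H, IH. simpl. ring.
Qed.

(** Multiplying by [1 - c S] makes the eigenvalue equation of [phi (S_beta)] linear in [S_beta]. It
    becomes a multiple of [S f - mu f] with factor [w (1 - c z0) / (1 - c mu)], nonzero as
    [Cmod z0 < 1]. *)
Lemma moebius_op_eigenvector (beta : nat -> R) (theta : R) (z0 mu : C) (f : nat -> C) :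
  admissible_weight beta -> unit_disk z0 -> unit_disk mu -> H2 beta f ->
  (forall k, moebius_op theta z0 f k = (moebius theta z0 mu * f k)%C) <->
  (forall k, S_beta f k = (mu * f k)%C).
Proof.
intros H H0 Hm Hf. assert (D := moebius_den_neq0 z0 mu H0 Hm).
assert (D0 := moebius_den_neq0 z0 z0 H0 H0).
set (w := (cos theta, sin theta) : C).
assert (Nw : w <> 0%C).
{ intro E. assert (T := Cmod_cis theta). fold w in T. rewrite E, Cmod_0 in T. lra. }
assert (C1 : Cmod (Cconj z0) < 1) by now rewrite Cmod_conj.
unfold moebius_op, moebius. fold w. set (c := Cconj z0) in *.
split; intros E k.
- assert (N : forall k, neumann c f k = (f k + c * neumann c f (S k))%C)
    by (intro; now apply (neumann_rec beta)).
  (* Coordinate [k] minus [c] times coordinate [S k] is the effect of [1 - c S], which removes the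
     Neumann series. *)
  assert (E1 := E k). assert (E2 := E (S k)). unfold S_beta, PS_decr_1 in *.
  assert (N1 := N k). assert (N2 := N (S k)).
  set (u0 := neumann c f k) in *. set (u1 := neumann c f (S k)) in *.
  set (u2 := neumann c f (S (S k))) in *.
  assert (X : (w * z0 * f k - w * f (S k)
    = w * ((z0 - mu) / (1 - c * mu)) * f k - c * (w * ((z0 - mu) / (1 - c * mu)) * f (S k)))%C).
  { rewrite <- E1, <- E2, N1. transitivity (w * z0 * (f k + c * u1) + - w * u1
      - c * (w * z0 * u1 + - w * u2))%C; [|ring].
    replace (w * f (S k))%C with (w * (u1 - c * u2))%C by (rewrite N2; ring). ring. }
  assert (Y : (w * (1 - c * z0) / (1 - c * mu) * f (S k)
    = w * (1 - c * z0) / (1 - c * mu) * (mu * f k))%C).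
  { transitivity (w * f (S k) - c * (w * ((z0 - mu) / (1 - c * mu)) * f (S k)))%C;
      [field; exact D|].
    replace (w * f (S k))%C with (w * z0 * f k - (w * z0 * f k - w * f (S k)))%C by ring.
    rewrite X. field. exact D. }
  transitivity ((1 - c * mu) / (w * (1 - c * z0))
    * (w * (1 - c * z0) / (1 - c * mu) * f (S k)))%C; [field; auto|].
  rewrite Y. field. auto.
- assert (G : neumann c f = (fun k => / (1 - c * mu) * f k)%C).
  { rewrite <- (neumann_left beta c (fun k => / (1 - c * mu) * f k)%C) by
      (trivial; now apply H2_scal).
    f_equal. apply functional_extensionality. intro j. unfold S_beta, PS_decr_1 in *.
    rewrite E. field. exact D. }
  rewrite G. unfold S_beta, PS_decr_1 in *. rewrite E. field. exact D.
Qed.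

Lemma unit_polar (z : C) : exists e : C, Cmod e = 1 /\ (z = Cmod z * e)%C /\ (e * Cconj e)%C = 1%C.
Proof.
assert (U : forall e, Cmod e = 1 -> (e * Cconj e)%C = 1%C).
{ intros e He. assert (T := Cmod_sqr_parts e). rewrite He in T. destruct e as [x y].
  simpl in T. apply injective_projections; simpl; lra. }
destruct (Ceq_dec z 0) as [E|N].
- exists 1%C. rewrite E, Cmod_0. split; [apply Cmod_1|]. split; [ring|]. apply U, Cmod_1.
- assert (P := proj1 (Cmod_gt_0 z) N).
  assert (N' : RtoC (Cmod z) <> 0%C) by (intro F; injection F; lra).
  exists (z / Cmod z)%C.
  assert (M : Cmod (z / Cmod z) = 1).
  { rewrite Cmod_div, Cmod_R, Rabs_pos_eq by (trivial; lra). field. lra. }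
  split; [exact M|]. split; [field; exact N'|]. now apply U.
Qed.

Lemma similarity (beta : nat -> R) (theta : R) (z0 : C) :
  admissible_weight beta -> polynomial_growth beta -> unit_disk z0 ->
  exists X, bounded_invertible beta X /\
    forall omega, unit_disk omega -> X (kernel omega) = kernel (moebius theta z0 omega).
Proof.
intros H Hg H0. unfold unit_disk in H0.
destruct (unit_polar z0) as [e [Me [Ez Ee]]].
(* With [z0 = m e], [m = Cmod z0], the automorphism is [- w e] times [psi_(-m)] evaluated at
   [Cconj e * omega]. The two rotations act on coefficients as diagonal unitaries. *)
set (s := - Cmod z0). assert (P0 := Cmod_ge_0 z0).
assert (Hs : Rabs s < 1) by (unfold s; rewrite Rabs_Ropp, Rabs_pos_eq; lra).
assert (Hs' : Rabs (- s) < 1) by now rewrite Rabs_Ropp.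
set (w := (cos theta, sin theta) : C). assert (Mw : Cmod w = 1) by apply Cmod_cis.
assert (Ew : (w * Cconj w)%C = 1%C).
{ assert (T := sin2_cos2 theta). unfold Rsqr in T.
  apply injective_projections; simpl; lra. }
set (a := (- (w * e))%C). set (a' := (- (Cconj w * Cconj e))%C).
assert (Ma : Cmod a = 1) by (unfold a; rewrite Cmod_opp, Cmod_mult, Mw, Me; ring).
assert (Ma' : Cmod a' = 1) by (unfold a'; rewrite Cmod_opp, Cmod_mult, !Cmod_conj, Mw, Me; ring).
assert (Mb : Cmod (Cconj e) = 1) by now rewrite Cmod_conj.
assert (Ea : (a * a')%C = 1%C).
{ unfold a, a'. transitivity ((w * Cconj w) * (e * Cconj e))%C; [ring|].
  rewrite Ew, Ee. ring. }
exists (fun f => diag a (comp_op s (diag (Cconj e) f))). split.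
- assert (Bs := comp_op_bounded beta s H Hg Hs).
  assert (Bs' := comp_op_bounded beta (- s) H Hg Hs').
  assert (B : forall x y t, Cmod x = 1 -> Cmod y = 1 -> bounded_operator beta (comp_op t) ->
    bounded_operator beta (fun f => diag x (comp_op t (diag y f)))).
  { intros x y t Hx Hy Ht. apply bounded_operator_comp; [now apply diag_bounded|].
    apply bounded_operator_comp; [exact Ht|now apply diag_bounded]. }
  split; [now apply B|].
  exists (fun f => diag e (comp_op (- s) (diag a' f))). split; [now apply B|].
  intros f Hf. split.
  + rewrite (diag_inverse a' a) by (rewrite Cmult_comm; exact Ea).
    rewrite (comp_op_inverse beta) by (trivial; now apply diag_bounded).
    now apply diag_inverse.
  + rewrite (diag_inverse (Cconj e) e) by (rewrite Cmult_comm; exact Ee).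
    rewrite <- (Ropp_involutive s) at 1.
    rewrite (comp_op_inverse beta) by (trivial; now apply diag_bounded).
    now apply diag_inverse.
- intros omega Ho. rewrite diag_kernel, (comp_op_kernel beta), diag_kernel; trivial.
  2: { unfold unit_disk. rewrite Cmod_mult, Mb, Rmult_1_l. exact Ho. }
  f_equal. unfold moebius. fold w.
  assert (D := moebius_den_neq0 z0 omega H0 Ho).
  assert (Cz : Cconj z0 = (Cmod z0 * Cconj e)%C).
  { rewrite Ez at 1. destruct e as [x y]. apply injective_projections; simpl; ring. }
  assert (Ne : e <> 0%C) by (intro F; rewrite F, Cmod_0 in Me; lra).
  assert (Ec : Cconj e = (/ e)%C).
  { transitivity (/ e * (e * Cconj e))%C; [field; exact Ne|]. rewrite Ee. ring. }
  rewrite Cz in *. rewrite Ec in *. unfold s, a. rewrite RtoC_opp.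
  rewrite Ez at 3. set (m := RtoC (Cmod z0)) in *.
  assert (D' : (e - m * omega)%C <> 0%C).
  { intro F. apply D. replace (1 - m * / e * omega)%C with (/ e * (e - m * omega))%C
      by (field; exact Ne). rewrite F. ring. }
  field. repeat split; trivial.
Qed.

Theorem corollary3p7 :
  forall beta : nat -> R,
    admissible_weight beta -> polynomial_growth beta ->
    forall phi : C -> C, Aut_disk phi ->
      (exists phiS : operator, is_hol_calculus beta S_beta phi phiS) /\
      (forall phiS : operator, is_hol_calculus beta S_beta phi phiS ->
         similar beta (ker_bundle beta S_beta) (ker_bundle beta phiS)).
Proof.
intros beta H Hg phi [theta [z0 [H0 Hphi]]]. split.
- exists (moebius_op theta z0). now apply hol_calculus_exists.
- intros A HA. assert (EA := hol_calculus_unique beta phi theta z0 A H H0 Hphi HA).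
  set (w0 := ((cos theta, sin theta) * z0)%C).
  assert (Hw : unit_disk w0)
    by (unfold unit_disk, w0; rewrite Cmod_mult, Cmod_cis, Rmult_1_l; exact H0).
  (* The inverse automorphism is used: the fibre of [phi (S_beta)] over [omega] is spanned by the
     kernel at [mu = phi^(-1)(omega)]. *)
  destruct (similarity beta (- theta) w0 H Hg Hw) as [X [BX KX]].
  assert (LX := bounded_linear _ _ (proj1 BX)).
  exists X. split; [exact BX|]. intros omega Ho g.
  set (mu := moebius (- theta) w0 omega).
  assert (Hmu : unit_disk mu) by now apply moebius_disk.
  assert (Emu : moebius theta z0 mu = omega) by now apply moebius_inverse.
  assert (Ko := kernel_H2 beta omega H Ho). assert (Km := kernel_H2 beta mu H Hmu).
  assert (Sub : forall x y : C, (x - y)%C = 0%C <-> x = y).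
  { intros x y. split; intro E; [|rewrite E; ring].
    replace x with (x - y + y)%C by ring. rewrite E. ring. }
  assert (Eig : forall nu, forall k, S_beta (kernel nu) k = (nu * kernel nu k)%C)
    by reflexivity.
  split.
  + intros [Hgg Eg].
    assert (E : forall k, S_beta g k = (mu * g k)%C).
    { apply (moebius_op_eigenvector beta theta z0 mu g H H0 Hmu Hgg).
      intro k. rewrite Emu, <- EA by exact Hgg. now apply Sub. }
    (* Since [g] is [g 0] times the kernel at [mu], its preimage is the same multiple of the kernel
       at [omega]. *)
    exists (fun k => g 0%nat * kernel omega k)%C. split.
    * split; [now apply H2_scal|]. intro k. apply Sub.
      unfold S_beta, PS_decr_1, kernel. simpl. ring.
    * rewrite (linear_on_scal beta) by assumption. rewrite KX by exact Ho.
      now apply S_beta_eigenvector.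
  + intros [f [[Hf Ef] ->]].
    assert (E : f = (fun k => f 0%nat * kernel omega k)%C).
    { apply S_beta_eigenvector. intro k. now apply Sub. }
    assert (EX : X f = (fun k => f 0%nat * kernel mu k)%C).
    { rewrite E at 1. rewrite (linear_on_scal beta) by assumption. now rewrite KX by exact Ho. }
    assert (HX : H2 beta (X f)) by now apply (proj1 BX).
    split; [exact HX|]. intro k. apply Sub. rewrite EA by exact HX.
    rewrite <- Emu. revert k.
    apply (moebius_op_eigenvector beta theta z0 mu _ H H0 Hmu HX).
    intro k. rewrite EX. unfold S_beta, PS_decr_1, kernel. simpl. ring.
Qed.
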